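(* Let $D=\bigcup_{n\in\mathbb{N}_0}\mathbb{Q}[X^{\frac{1}{2^n}},X^{-\frac{1}{2^n}}]$, $R=\bigcup_{n\in\mathbb{N}_0}\mathbb{Q}[X^{\frac{1}{2^n}}]$, and let $S$ be the set of monic polynomials of $R$ with nonzero constant term that are prime elements of $D$. Let $\{a_p\}_{p\in S}$ be a family of nonnegative integers such that $T:=\{p\in S\mid a_p>0\}$ is infinite. Then $\prod_{p\in S}p^{a_p}\in D$ if and only if there exist a finite subset $\mathcal{C}$ of $T$, a nonnegative integer $n$ and distinct positive odd integers $d_1,\dots,d_l$ such that the following two conditions hold: (1) $T\setminus\mathcal{C}=\bigcup_{j=1}^{l}\{\Phi_{2d_j}(X^{\frac{1}{2^i}})\mid i>n\}$. (2) For each $j\in\{1,\dots,l\}$, letting $\mathcal{B}_j=\{p\in T\mid p=\Phi_{2d_j}(X^{\frac{1}{2^i}})\text{ for some } i\ge n\}$ and $b_j=\min\{a_p\mid p\in\mathcal{B}_j\}$, one has $a_p=b_j$ for all but finitely many $p\in\mathcal{B}_j$. In this case, $\{a_p \mid p\in S\}$ is a finite set.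
   Context: $\mathbb{N}_0$ is the set of nonnegative integers, $X$ is an indeterminate over $\mathbb{Q}$, and the elements $X^{1/2^n}$ are compatible roots of $X$, i.e. $(X^{1/2^{n+1}})^2=X^{1/2^n}$. $\Phi_d$ denotes the $d$-th cyclotomic polynomial. Every prime element of $D$ is associated to exactly one element of $S$; for odd $d$ and $i\ge 0$, $\Phi_{2d}(X^{1/2^i})\in S$. Infinite product: for a nonzero nonunit $f$ of $D$ and nonnegative integers $k_p$ $(p\in S)$, one writes $f=u_f\prod_{p\in S}p^{k_p}$ if (i) for each $p\in S$, $p^{k_p}\mid f$ but $p^{k_p+1}\nmid f$ in $D$; and (ii) whenever $g\in D$ is such that $p^{k_p}\mid g$ but $p^{k_p+1}\nmid g$ for each $p\in S$, then $gD\subseteq fD$. Here $u_f$ is the unit of $D$ such that $f=u_ff_1$ for a monic polynomial $f_1$ of $R$ with $f_1(0)\neq 0$. The statement ''$\prod_{p\in S}p^{k_p}\in D$'' means that there exists a nonzero nonunit $f$ of $D$ satisfying (i) and (ii) for the family $\{k_p\}_{p\in S}$ (with unit $u_f=1$). *)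

(* Defs.v *)
From HB Require Import structures.
From mathcomp Require Import all_boot all_order all_algebra cyclotomic.
From mathcomp Require Import boolp classical_sets functions cardinality.

Set Implicit Arguments.
Unset Strict Implicit.
Unset Printing Implicit Defensive.

Import Order.TTheory GRing.Theory Num.Theory.
Local Open Scope classical_set_scope.
Local Open Scope ring_scope.

(* The rings D and R are realised inside an arbitrary field L equipped with an
   embedding iota of the rationals and a sequence x : nat -> L, where x n plays
   the role of X^(1/2^n): x 0 is required to be transcendental over Q and
   x (n+1)^2 = x n.  These requirements determine D and R up to isomorphism. *)
Definition dyadic_roots (L : fieldType) (iota : {rmorphism rat -> L})
    (x : nat -> L) : Prop :=
  ~ algebraicOver iota (x 0%N) /\ forall n, x n.+1 ^+ 2 = x n.

(* The element p(X^(1/2^n)). *)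
Definition ev (L : fieldType) (iota : {rmorphism rat -> L}) (x : nat -> L)
    (n : nat) (p : {poly rat}) : L :=
  (map_poly iota p).[x n].

(* A Laurent polynomial in Y is p(Y) / Y^k for a polynomial p and some k. *)
Definition Dring (L : fieldType) (iota : {rmorphism rat -> L}) (x : nat -> L)
    : set L :=
  [set f | exists n p k, f = ev iota x n p / x n ^+ k].

(* The elements of R are the ev n p.  Neither "monic" nor "nonzero
   constant term" depends on the choice of n. *)
Definition monic_nzconst (L : fieldType) (iota : {rmorphism rat -> L})
    (x : nat -> L) : set L :=
  [set f | exists n p, [/\ p \is monic, p.[0] != 0 & f = ev iota x n p]].

Definition divides (L : fieldType) (A : set L) (f g : L) : Prop :=
  exists2 h, A h & g = f * h.

Definition unit_in (L : fieldType) (A : set L) (f : L) : Prop :=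
  A f /\ divides A f 1.

Definition prime_in (L : fieldType) (A : set L) (p : L) : Prop :=
  [/\ A p, p != 0, ~ unit_in A p &
      forall f g, A f -> A g -> divides A p (f * g) ->
        divides A p f \/ divides A p g].

Definition principal (L : fieldType) (A : set L) (f : L) : set L :=
  [set f * h | h in A].

Definition Sset (L : fieldType) (iota : {rmorphism rat -> L}) (x : nat -> L)
    : set L :=
  [set p | monic_nzconst iota x p /\ prime_in (Dring iota x) p].

(* p^(k p) exactly divides g in D, for every p in Sset.  A family
   indexed by Sset is a function on L of which only the values on Sset matter. *)
Definition exact_divs (L : fieldType) (iota : {rmorphism rat -> L})
    (x : nat -> L) (k : L -> nat) (g : L) : Prop :=
  forall p, Sset iota x p ->
    divides (Dring iota x) (p ^+ k p) g /\ ~ divides (Dring iota x) (p ^+ (k p).+1) g.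

(* f = u * \prod_(p in Sset) p^(k p) *)
Definition is_prod (L : fieldType) (iota : {rmorphism rat -> L})
    (x : nat -> L) (k : L -> nat) (u f : L) : Prop :=
  [/\ [/\ Dring iota x f, f != 0 & ~ unit_in (Dring iota x) f],
      exact_divs iota x k f,
      forall g, Dring iota x g -> exact_divs iota x k g ->
        principal (Dring iota x) g `<=` principal (Dring iota x) f &
      unit_in (Dring iota x) u /\ exists2 f1, monic_nzconst iota x f1 & f = u * f1].

Definition prod_in_D (L : fieldType) (iota : {rmorphism rat -> L})
    (x : nat -> L) (k : L -> nat) : Prop :=
  exists f, is_prod iota x k 1 f.

Definition Tset (L : fieldType) (iota : {rmorphism rat -> L}) (x : nat -> L)
    (a : L -> nat) : set L :=
  [set p | Sset iota x p /\ (0 < a p)%N].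

(* Phi_(2d)(X^(1/2^i)) *)
Definition Phi2 (L : fieldType) (iota : {rmorphism rat -> L}) (x : nat -> L)
    (d i : nat) : L :=
  ev iota x i (map_poly intr 'Phi_(2 * d)%N).

Definition Bset (L : fieldType) (iota : {rmorphism rat -> L}) (x : nat -> L)
    (a : L -> nat) (n d : nat) : set L :=
  [set p | Tset iota x a p /\ exists2 i, (n <= i)%N & p = Phi2 iota x d i].

Definition is_min (A : set nat) (m : nat) : Prop :=
  A m /\ forall k, A k -> (m <= k)%N.

(* Main.v *)
Require Import Defs.
From mathcomp Require Import all_boot all_order all_algebra algC cyclotomic.
From mathcomp Require Import boolp classical_sets functions cardinality.
From mathcomp Require Import zify ring.

Set Implicit Arguments.
Unset Strict Implicit.
Unset Printing Implicit Defensive.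

Import Order.TTheory GRing.Theory Num.Theory.
Local Open Scope classical_set_scope.
Local Open Scope ring_scope.

(* For odd [d], [Phi_d(Y^2) = Phi_d(Y) Phi_2d(Y)], while every
   [Phi_2d(Y^(2^k))] is irreducible; so [Phi_d(X^(1/2^N))] behaves like the
   infinite product of the primes [Phi_2d(X^(1/2^i))], [i > N].  The main point
   is that nothing else happens: for [p(0) <> 0], some [p(Y^(2^k))] is a product
   of polynomials that stay irreducible under all substitutions [Y -> Y^(2^m)]
   and of polynomials [Phi_d], [d] odd.  Otherwise there is an infinite sequence
   of irreducible [q_i] of constant degree with [q_(i+1) | q_i(Y^2)]; the degree
   cannot double again and again, because if [q(Y^2)] is irreducible and [q(Y^4)]
   is not, then [-1] becomes a square modulo [q(Y^2)], and from then on
   irreducibility of [q(Y^2)] implies that of all [q(Y^(2^k))].  Up to scalars the [q_i]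
   are integer polynomials with bounded leading coefficients and bounded roots,
   so two of them coincide; their roots are then roots of unity, and some [q_i]
   is cyclotomic.  Hence every nonzero [f] in [D] is a unit times a finite product
   of primes and of [Phi_d(X^(1/2^N))], from which both directions are read off;
   moreover exact divisibility data determine [f] up to a unit. *)

(** * Substituting powers of the variable *)

Lemma comp_Xn_mul (R : comNzRingType) (p : {poly R}) m n :
  (p \Po 'X^m) \Po 'X^n = p \Po 'X^(m * n).
Proof. by rewrite -comp_polyA comp_Xn_poly -exprM mulnC. Qed.

Lemma size_comp_Xn (R : idomainType) (p : {poly R}) n :
  (size (p \Po 'X^n)).-1 = ((size p).-1 * n)%N.
Proof. by rewrite size_comp_poly size_polyXn. Qed.

Lemma comp_Xn_eq0 (R : idomainType) (p : {poly R}) n :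
  (0 < n)%N -> (p \Po 'X^n == 0) = (p == 0).
Proof. by move=> n0; rewrite comp_poly_eq0 // size_polyXn. Qed.

Lemma monic_comp_Xn (R : idomainType) (p : {poly R}) n :
  (0 < n)%N -> p \is monic -> p \Po 'X^n \is monic.
Proof.
move=> n0 /monicP pm; rewrite monicE lead_coef_comp ?size_polyXn //.
by rewrite pm lead_coefXn expr1n mulr1.
Qed.

Lemma horner0_comp_Xn (R : comNzRingType) (p : {poly R}) n :
  (0 < n)%N -> (p \Po 'X^n).[0] = p.[0].
Proof. by move=> n0; rewrite horner_comp hornerXn expr0n gtn_eqF. Qed.

(* [size p] elaborates through different structure paths, which are convertible
   but distinct atoms for [lia]. *)
Ltac size_lia :=
  repeat match goal with
    H : is_true (negb (@eq_op _ ?p _)) |- _ => rewrite -size_poly_gt0 in H end;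
  repeat match goal with H : context [@size _ (@polyseq _ _)] |- _ => revert H end;
  repeat match goal with |- context [@size ?T1 (@polyseq ?R1 ?p1)] =>
    match goal with |- context [@size ?T2 (@polyseq ?R2 ?p2)] =>
      tryif constr_eq (@size T1 (@polyseq R1 p1)) (@size T2 (@polyseq R2 p2)) then fail else
      change (@size T2 (@polyseq R2 p2)) with (@size T1 (@polyseq R1 p1))
    end end;
  lia.

(** Substitution carries division with remainder by [p] to division with remainder by [p \Po 'X^n],
    since it multiplies all degrees by [n]; a nonzero remainder stays nonzero and too small to be
    divisible. *)
Lemma dvdp_comp_Xn (F : fieldType) (p q : {poly F}) n :
  (0 < n)%N -> (p \Po 'X^n %| q \Po 'X^n) = (p %| q).
Proof.
move=> n0; apply/idP/idP; last exact: dvdp_comp_poly.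
have [->|p0] := eqVneq p 0.
  by rewrite comp_poly0 !dvd0p comp_Xn_eq0.
rewrite {1}(divp_eq q p) comp_polyD comp_polyM dvdp_addr ?dvdp_mull //.
move=> dv; apply/modp_eq0P/eqP; rewrite -(comp_Xn_eq0 _ n0).
apply: contraTT dv => r0; apply/negP => /(dvdp_leq r0).
have lt := ltn_modpN0 q p0; rewrite comp_Xn_eq0 // in r0.
have : ((size (q %% p)%R).-1 * n < (size p).-1 * n)%N.
  by rewrite ltn_pmul2r //; size_lia.
by rewrite -!size_comp_Xn; size_lia.
Qed.

Lemma irreducible_comp_Xn (F : fieldType) (p : {poly F}) n : (0 < n)%N ->
  irreducible_poly (p \Po 'X^n) -> irreducible_poly p.
Proof.
move=> n0 [sp irr]; have p0 : p != 0.
  by rewrite -(comp_Xn_eq0 _ n0) -size_poly_gt0 (ltn_trans _ sp).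
(* [size_comp_Xn] compares predecessors of sizes, so the size 0 has to be excluded by [r != 0]. *)
have sz (r : {poly F}) : r != 0 -> (size r == 1%N) = (size (r \Po 'X^n) == 1%N).
  move=> r0; have e := size_comp_Xn r n.
  have r1 : r \Po 'X^n != 0 by rewrite comp_Xn_eq0.
  have : ((size r).-1 * n == 0)%N = ((size r).-1 == 0)%N.
    by rewrite muln_eq0 (gtn_eqF n0) orbF.
  by size_lia.
split.
  have := sz _ p0; size_lia.
move=> q sq qp; have q0 : q != 0 by apply: contraTneq qp => ->; rewrite dvd0p.
have /irr : size (q \Po 'X^n) != 1%N by rewrite -sz.
by rewrite dvdp_comp_Xn // qp => /(_ isT); rewrite /eqp !dvdp_comp_Xn.
Qed.

Lemma irreducible_dvdpM (F : fieldType) (p q r : {poly F}) :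
  irreducible_poly p -> p %| q * r -> (p %| q) || (p %| r).
Proof.
move=> irr; have [//|pq] := boolP (p %| q).
by rewrite Gauss_dvdpr // irreducible_poly_coprime.
Qed.

Lemma irreducible_monic_dvd_eq (F : fieldType) (p q : {poly F}) :
  irreducible_poly p -> irreducible_poly q -> p \is monic -> q \is monic ->
  p %| q -> p = q.
Proof.
move=> [sp _] [_ irr] pm qm pq; apply/eqP; rewrite -eqp_monic //.
by apply: irr => //; rewrite gtn_eqF.
Qed.

Lemma not_irreducible (F : fieldType) (p : {poly F}) :
  (1 < size p)%N -> ~ irreducible_poly p ->
  exists q : {poly F}, [/\ size q != 1%N, q %| p & ~~ (q %= p)].
Proof.
move=> sp nirr; apply: contrapT => nex; apply: nirr; split=> // q sq qp.
by apply/negPn/negP => nq; apply: nex; exists q.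
Qed.

(** * Even polynomials and the factors of q(X^2) *)

Lemma comp_oppXK (R : comNzRingType) (p : {poly R}) : (p \Po - 'X) \Po - 'X = p.
Proof. by rewrite -comp_polyA raddfN /= comp_polyX opprK comp_polyXr. Qed.

Lemma comp_X2_oppX (R : comNzRingType) (p : {poly R}) :
  (p \Po 'X^2) \Po - 'X = p \Po 'X^2.
Proof. by rewrite -comp_polyA comp_Xn_poly sqrrN. Qed.

Lemma size_comp_oppX (R : idomainType) (p : {poly R}) :
  size (p \Po - 'X) = size p.
Proof. by rewrite size_comp_poly2 // size_polyN size_polyX. Qed.

Lemma dvdp_comp_oppX (F : fieldType) (p q : {poly F}) :
  (p \Po - 'X %| q) = (p %| q \Po - 'X).
Proof.
apply/idP/idP => [/(dvdp_comp_poly (- 'X))|/(dvdp_comp_poly (- 'X))];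
  by rewrite comp_oppXK.
Qed.

(** Comparing [p] with [p(-X)] gives 2 X o(X^2) = 0 for the odd part [o], and 2 is invertible. *)
Lemma even_polyP (F : numFieldType) (p : {poly F}) :
  p \Po - 'X = p -> exists w, p = w \Po 'X^2.
Proof.
move=> pe; exists (even_poly p); move: pe; rewrite -{1 2}[p]poly_even_odd.
rewrite comp_polyD comp_polyM !comp_X2_oppX comp_polyX mulrN => /addrI.
move=> /eqP; rewrite eq_sym -subr_eq0 opprK -mulr2n -scaler_nat scaler_eq0 pnatr_eq0 /=.
rewrite mulf_eq0 polyX_eq0 orbF => /eqP o0.
by rewrite -{1}[p]poly_even_odd o0 mul0r addr0.
Qed.

(* The gcd of [t] and [t(-X)] is even, so it comes from a divisor of [q]: these two
   polynomials are coprime and their even product comes from a divisor of [q]. *)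
Lemma comp_X2_factor (F : numFieldType) (q t : {poly F}) :
  irreducible_poly q -> q.[0] != 0 -> size t != 1%N -> t %| q \Po 'X^2 ->
  ~~ (t %= q \Po 'X^2) ->
  q \Po 'X^2 %= t * (t \Po - 'X) /\ size t = size q.
Proof.
move=> qirr q0 st tQ ntQ; set Q := q \Po 'X^2 in tQ ntQ *.
have Q0 : Q != 0 by rewrite comp_Xn_eq0 // irredp_neq0.
have t0 : t != 0 by apply: contraTneq tQ => ->; rewrite dvd0p.
have t'Q : t \Po - 'X %| Q by rewrite dvdp_comp_oppX comp_X2_oppX.
(* Even divisors of [Q] come from divisors of the irreducible [q], so only the trivial ones
   exist. *)
have dich w : w != 0 -> w \Po 'X^2 %| Q -> size w = 1%N \/ Q %= w \Po 'X^2.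
  move=> w0; rewrite dvdp_comp_Xn // => wq.
  have [sw|sw] := eqVneq (size w) 1%N; [by left|right].
  by rewrite eqp_sym /eqp !dvdp_comp_Xn //; apply: (apply_irredp qirr).
have cop : coprimep t (t \Po - 'X).
  set d := gcdp t (t \Po - 'X).
  have dt : d %| t by apply: dvdp_gcdl.
  have dQ : d %| Q by apply: dvdp_trans tQ.
  have d00 : d.[0] != 0.
    apply: contraNneq q0 => /eqP d0; have : root Q 0.
      by exact: root_dvdp dQ d0.
    by rewrite rootE horner0_comp_Xn.
  have : d \Po - 'X %= d.
    apply: eqp_trans (gcdp_comp_poly _ _ _) _; rewrite comp_oppXK.
    exact: gcdpC.
  move=> /eqpf_eq[c c0 dc].
  (* Comparing the nonzero constant terms excludes the sign -1, that is, an odd gcd. *)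
  have c1 : c = 1.
    move: (congr1 (fun r : {poly F} => r.[0]) dc).
    rewrite horner_comp hornerN hornerX oppr0 hornerZ.
    by rewrite -[X in X = _]mul1r => /(mulIf d00).
  have [w dw] : exists w, d = w \Po 'X^2.
    by apply: even_polyP; rewrite dc c1 scale1r.
  have w0 : w != 0 by rewrite -(@comp_Xn_eq0 _ w 2) // -dw gcdp_eq0 negb_and t0.
  rewrite /coprimep -/d dw.
  case: (dich w w0); rewrite -?dw //.
    move=> sw; rewrite dw; have := size_comp_Xn w 2; rewrite sw.
    by move: w0; rewrite -(@comp_Xn_eq0 _ w 2) // -size_poly_gt0; size_lia.
  move=> Qd; case/negP: ntQ; rewrite /eqp tQ /=.
  by rewrite (eqp_dvdl _ Qd).
have prQ : t * (t \Po - 'X) %| Q by rewrite Gauss_dvdp // tQ.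
have [w dw] : exists w, t * (t \Po - 'X) = w \Po 'X^2.
  by apply: even_polyP; rewrite comp_polyM comp_oppXK mulrC.
have t'0 : t \Po - 'X != 0 by rewrite -size_poly_gt0 size_comp_oppX size_poly_gt0.
have w0 : w != 0 by rewrite -(@comp_Xn_eq0 _ w 2) // -dw mulf_neq0.
have Qw : Q %= w \Po 'X^2.
  case: (dich w w0); rewrite -?dw // => sw.
  have : size (t * (t \Po - 'X)) = 1%N.
    have := size_comp_Xn w 2; rewrite sw dw; move: w0.
    by rewrite -(@comp_Xn_eq0 _ w 2) // -size_poly_gt0; size_lia.
  rewrite size_mul // size_comp_oppX.
  by move: t0 st; rewrite -size_poly_gt0; size_lia.
split; first by rewrite dw.
move: (eqp_size Qw); rewrite -dw size_mul // size_comp_oppX.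
have := size_comp_Xn q 2; rewrite -/Q; move: t0 Q0; rewrite -!size_poly_gt0.
have := irredp_neq0 qirr; rewrite -size_poly_gt0; size_lia.
Qed.

(** By [comp_X2_factor] every nontrivial divisor of q(X^2) has the size of [q]. A nontrivial divisor
    of such a [t] is again one of q(X^2), so it has the size of [t]; hence [t] is irreducible. *)
Lemma comp_X2_split (F : numFieldType) (q : {poly F}) :
  irreducible_poly q -> q.[0] != 0 -> ~ irreducible_poly (q \Po 'X^2) ->
  exists t, [/\ q \Po 'X^2 %= t * (t \Po - 'X), irreducible_poly t
    & size t = size q].
Proof.
move=> qirr q0 /not_irreducible[].
  by have := size_comp_Xn q 2; case: qirr; size_lia.
move=> t [st tQ ntQ]; have [e s] := comp_X2_factor qirr q0 st tQ ntQ.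
exists t; split=> //; split; first by case: qirr; rewrite s.
move=> u su ut.
have t0 : t != 0 by rewrite -size_poly_gt0 s size_poly_gt0 irredp_neq0.
have [_ s'] : q \Po 'X^2 %= u * (u \Po - 'X) /\ size u = size q.
  apply: comp_X2_factor => //; first exact: dvdp_trans tQ.
  apply: contra ntQ => /andP[_ Qu]; rewrite /eqp tQ.
  exact: dvdp_trans ut.
by rewrite -dvdp_size_eqp // s s'.
Qed.

(** * Irreducibility of [q(Y^2)] and [q(Y^4)] *)

Lemma irreducible_comp_X2_dvdp_oppX (F : fieldType) (q r : {poly F}) :
  (q \Po 'X^2 %| r \Po - 'X) = (q \Po 'X^2 %| r).
Proof. by rewrite -dvdp_comp_oppX comp_X2_oppX. Qed.

(* With [q(X^4) = t(X) t(-X)] and [t = A(X^2) + X B(X^2)] one gets [A^2 = X B^2]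
   modulo [q(X^2)]; take [u] and [v] to be the norms [A(X) A(-X)], [B(X) B(-X)]. *)
Lemma comp_X4_reducible (F : numFieldType) (q : {poly F}) :
  q.[0] != 0 -> irreducible_poly (q \Po 'X^2) ->
  ~ irreducible_poly (q \Po 'X^4) ->
  exists u v : {poly F}, [/\ u \Po - 'X = u, v \Po - 'X = v,
    q \Po 'X^2 %| u ^+ 2 + ('X * v) ^+ 2 & ~~ (q \Po 'X^2 %| v)].
Proof.
move=> q0 rirr; rewrite -[4%N]/(2 * 2)%N -comp_Xn_mul => nirr.
set r := q \Po 'X^2 in rirr nirr *.
have r0 : r.[0] != 0 by rewrite horner0_comp_Xn.
have [t [rt tirr st]] := comp_X2_split rirr r0 nirr.
set A := even_poly t; set B := odd_poly t.
have tE : t = A \Po 'X^2 + (B \Po 'X^2) * 'X by rewrite poly_even_odd.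
have dAB : r %| A ^+ 2 - 'X * B ^+ 2.
  rewrite -(@dvdp_comp_Xn _ _ _ 2) // (eqp_dvdl _ rt).
  suff -> : (A ^+ 2 - 'X * B ^+ 2) \Po 'X^2 = t * (t \Po - 'X) by apply: dvdpp.
  rewrite tE.
  rewrite !expr2 !(comp_polyB, comp_polyD, comp_polyM, comp_X2_oppX, comp_polyX).
  by ring.
have dAB' : r %| (A \Po - 'X) ^+ 2 + 'X * (B \Po - 'X) ^+ 2.
  rewrite -irreducible_comp_X2_dvdp_oppX in dAB.
  by rewrite !expr2 comp_polyB !comp_polyM comp_polyX mulNr opprK -!expr2 in dAB.
exists (A * (A \Po - 'X)), (B * (B \Po - 'X)); split.
- by rewrite comp_polyM comp_oppXK mulrC.
- by rewrite comp_polyM comp_oppXK mulrC.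
- rewrite [X in _ %| X](_ : _ =
    (A \Po - 'X) ^+ 2 * (A ^+ 2 - 'X * B ^+ 2) +
    ('X * B ^+ 2) * ((A \Po - 'X) ^+ 2 + 'X * (B \Po - 'X) ^+ 2)); last by ring.
  by rewrite dvdp_add // dvdp_mull.
apply/negP => /(irreducible_dvdpM rirr).
rewrite irreducible_comp_X2_dvdp_oppX orbb => rB.
have rA : r %| A.
  have : r %| A * A.
    rewrite -expr2 -(subrK ('X * B ^+ 2) (A ^+ 2)) dvdp_add //.
    by rewrite dvdp_mull // expr2 dvdp_mull.
  by move=> /(irreducible_dvdpM rirr); rewrite orbb.
have : r \Po 'X^2 %| t.
  by rewrite tE dvdp_add ?dvdp_mulr // dvdp_comp_Xn.
move=> /(dvdp_leq (irredp_neq0 tirr)).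
have := size_comp_Xn r 2; case: rirr; size_lia.
Qed.

(* [-1] is a square in the field [F[X]/(s)], for [s] irreducible. *)
Definition has_sqrtN1 (F : fieldType) (s : {poly F}) : Prop :=
  exists u v : {poly F}, s %| u ^+ 2 + v ^+ 2 /\ coprimep s v.

(** X -> X^n induces a ring morphism from F[X]/(s) to F[X]/(t), which carries a square root of -1 to
    one. *)
Lemma has_sqrtN1_dvd_comp (F : fieldType) (s t : {poly F}) n :
  has_sqrtN1 s -> t %| s \Po 'X^n -> has_sqrtN1 t.
Proof.
move=> [u [v [d c]]] ts; exists (u \Po 'X^n), (v \Po 'X^n); split.
  by apply: dvdp_trans ts _; rewrite -!rmorphXn -comp_polyD dvdp_comp_poly.
exact: coprimep_dvdr ts (coprimep_comp_poly _ c).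
Qed.

Lemma coprimep_X (F : fieldType) (q : {poly F}) : q.[0] != 0 -> coprimep q 'X.
Proof. by rewrite -[X in coprimep _ X]subr0 -polyC0 coprimep_XsubC rootE. Qed.

(** In [comp_X4_reducible], X v is invertible modulo q(X^2), so u/(X v) squares to -1. *)
Lemma comp_X2_has_sqrtN1 (F : numFieldType) (q : {poly F}) :
  q.[0] != 0 -> irreducible_poly (q \Po 'X^2) ->
  ~ irreducible_poly (q \Po 'X^4) -> has_sqrtN1 (q \Po 'X^2).
Proof.
move=> q0 irr nirr; have [u [v [_ _ d nv]]] := comp_X4_reducible q0 irr nirr.
exists u, ('X * v); split=> //; rewrite coprimepMr coprimep_X ?horner0_comp_Xn //=.
by rewrite irreducible_poly_coprime.
Qed.

(** The given root of -1 pulls back to an even one modulo q(X^2), while a factorization of q(X^4)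
    would yield the odd one u/(X v). Two square roots of -1 in a field agree up to sign, but an even
    element and an odd one cannot agree unless both vanish. *)
Lemma has_sqrtN1_comp_X4 (F : numFieldType) (q : {poly F}) :
  q.[0] != 0 -> has_sqrtN1 q -> irreducible_poly (q \Po 'X^2) ->
  irreducible_poly (q \Po 'X^4).
Proof.
move=> q0 [g [h [dgh cqh]]] irr; apply: contrapT => nirr.
have [u [v [ue ve duv nv]]] := comp_X4_reducible q0 irr nirr.
have {}dgh : q \Po 'X^2 %| (g \Po 'X^2) ^+ 2 + (h \Po 'X^2) ^+ 2.
  by rewrite -!rmorphXn -comp_polyD dvdp_comp_poly.
have {}cqh : coprimep (q \Po 'X^2) (h \Po 'X^2) by apply: coprimep_comp_poly.
set G := g \Po 'X^2 in dgh; set H := h \Po 'X^2 in dgh cqh.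
(* If both factors below vanish modulo q(X^2), so does 2 H X v, although each of its factors is
   invertible. *)
have dv : q \Po 'X^2 %| G * u - H * ('X * v) ->
    q \Po 'X^2 %| G * u + H * ('X * v) -> False.
  move=> d1 d2; have := dvdp_sub d2 d1.
  have -> : G * u + H * ('X * v) - (G * u - H * ('X * v)) =
      (2%:R)%:P * (H * ('X * v)) by rewrite polyC_natr; ring.
  rewrite mul_polyC dvdpZr ?pnatr_eq0 // !Gauss_dvdpr //.
    by rewrite (negPf nv).
  by apply: coprimep_X; rewrite horner0_comp_Xn.
have : q \Po 'X^2 %| (G * u - H * ('X * v)) * (G * u + H * ('X * v)).
  rewrite [X in _ %| X](_ : _ = u ^+ 2 * (G ^+ 2 + H ^+ 2) -
     H ^+ 2 * (u ^+ 2 + ('X * v) ^+ 2)); last by ring.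
  by rewrite dvdp_sub // dvdp_mull.
(* Since [u], [v], [G], [H] are even, replacing X by -X exchanges the two factors. *)
move=> /(irreducible_dvdpM irr)/orP[] d;
  move: (d); rewrite -irreducible_comp_X2_dvdp_oppX;
  rewrite !(comp_polyB, comp_polyD, comp_polyM, comp_X2_oppX, comp_polyX) ue ve => d'.
- by apply: dv => //; move: d'; rewrite mulNr mulrN opprK.
- by apply: dv => //; move: d'; rewrite mulNr mulrN.
Qed.

Definition stable (F : fieldType) (q : {poly F}) : Prop :=
  forall k, irreducible_poly (q \Po 'X^(2 ^ k)).

(** Induction replacing [q] by q(X^2): the root of -1 persists, and [has_sqrtN1_comp_X4] gives the
    irreducibility needed for the next step. *)
Lemma has_sqrtN1_stable (F : numFieldType) (q : {poly F}) :
  q.[0] != 0 -> has_sqrtN1 q -> irreducible_poly (q \Po 'X^2) -> stable q.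
Proof.
move=> q0 iq irr [|k].
  by rewrite expr1 comp_polyXr; apply: irreducible_comp_Xn irr.
elim: k q q0 iq irr => [//|k IH] q q0 iq irr.
rewrite expnS -comp_Xn_mul; apply: IH.
- by rewrite horner0_comp_Xn.
- exact: has_sqrtN1_dvd_comp iq (dvdpp _).
- by rewrite comp_Xn_mul; apply: has_sqrtN1_comp_X4.
Qed.

(** [comp_X2_has_sqrtN1] applies at an exponent where irreducibility still holds but fails at the
    next one. *)
Lemma unstable_reducible (F : numFieldType) (q : {poly F}) : q.[0] != 0 ->
  irreducible_poly (q \Po 'X^2) -> ~ stable q ->
  exists k, has_sqrtN1 (q \Po 'X^(2 ^ k)) /\ irreducible_poly (q \Po 'X^(2 ^ k)).
Proof.
move=> q0 irr nst.
have /existsNP[k] : ~ forall k, irreducible_poly (q \Po 'X^(2 ^ k.+1)).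
  move=> h; apply: nst => -[|k]; last exact: h.
  by rewrite expr1 comp_polyXr; apply: irreducible_comp_Xn irr.
elim: k => [//|k IH] nirr.
have [irr'|] := pselect (irreducible_poly (q \Po 'X^(2 ^ k.+1))); last exact: IH.
exists k.+1; split=> //; rewrite expnSr -comp_Xn_mul; apply: comp_X2_has_sqrtN1.
- by rewrite horner0_comp_Xn // expn_gt0.
- by rewrite comp_Xn_mul -expnSr.
- by rewrite comp_Xn_mul -[4%N]/(2 * 2)%N mulnA -!expnSr.
Qed.

(** * Cyclotomic polynomials over the rationals *)

Definition PhiQ (n : nat) : {poly rat} := map_poly intr 'Phi_n.

Lemma map_ratr_intr (p : {poly int}) :
  map_poly (ratr : rat -> algC) (map_poly intr p) = map_poly intr p.
Proof. by rewrite -map_poly_comp; apply: eq_map_poly => c /=; rewrite ratr_int. Qed.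

(** [PhiQ n] is the minimal polynomial of [z] over the rationals. *)
Lemma PhiQ_dvd n (z : algC) (q : {poly rat}) : n.-primitive_root z ->
  root (map_poly ratr q) z = (PhiQ n %| q).
Proof.
move=> pz; have [p [mp _] ->] := minCpolyP z; congr (_ %| _).
apply: (@map_poly_inj _ _ (@ratr algC)).
by rewrite -mp (minCpoly_cyclotomic pz) -(Cintr_Cyclotomic pz) map_ratr_intr.
Qed.

Lemma root_PhiQ n (z : algC) : (0 < n)%N ->
  root (map_poly ratr (PhiQ n)) z = n.-primitive_root z.
Proof.
move=> n0; have [w pw] := C_prim_root_exists n0.
by rewrite map_ratr_intr (Cintr_Cyclotomic pw) root_cyclotomic.
Qed.

Lemma size_PhiQ n : size (PhiQ n) = (totient n).+1.
Proof. by rewrite size_rat_int_poly size_Cyclotomic. Qed.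

Lemma PhiQ_monic n : PhiQ n \is monic.
Proof. by rewrite monic_map ?Cyclotomic_monic. Qed.

(** A nonconstant divisor has a complex root, which is a primitive [n]-th root of unity; by
    [PhiQ_dvd] the divisor is then a multiple of [PhiQ n]. *)
Lemma PhiQ_irreducible n : (0 < n)%N -> irreducible_poly (PhiQ n).
Proof.
move=> n0; split; first by rewrite size_PhiQ ltnS totient_gt0.
move=> q sq qn; have q0 : q != 0.
  by apply: contraTneq qn => ->; rewrite dvd0p monic_neq0 ?PhiQ_monic.
have [z rz] : exists z : algC, root (map_poly ratr q) z.
  by apply: closed_rootP; rewrite size_map_poly.
have pz : n.-primitive_root z.
  by rewrite -root_PhiQ //; apply: root_dvdp rz; rewrite dvdp_map.
by rewrite /eqp qn -(PhiQ_dvd _ pz).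
Qed.

Lemma PhiQ_horner0 n : (0 < n)%N -> (PhiQ n).[0] != 0.
Proof.
move=> n0; apply/negP => r0.
have : root ('X^n - 1%:P : {poly rat}) 0.
  apply: root_dvdp r0; have [z pz] := C_prim_root_exists n0.
  rewrite -(PhiQ_dvd _ pz) rmorphB /= map_polyXn map_polyC /= rmorph1.
  by rewrite rootE !hornerE prim_expr_order // subrr.
by rewrite rootE !hornerE expr0n (gtn_eqF n0) sub0r oppr_eq0 oner_eq0.
Qed.

Lemma PhiQ_inj m n : (0 < m)%N -> (0 < n)%N -> PhiQ m = PhiQ n -> m = n.
Proof.
move=> m0 n0 e; have [z pz] := C_prim_root_exists m0.
have pz' : n.-primitive_root z by rewrite -root_PhiQ // -e root_PhiQ.
apply/eqP; rewrite eqn_dvd (prim_order_dvd pz) (prim_order_dvd pz').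
by rewrite !prim_expr_order // eqxx.
Qed.

Lemma totient_double n : (0 < n)%N ->
  totient (2 * n) = (if odd n then totient n else 2 * totient n)%N.
Proof.
move=> n0; case: ifP => [on|/negbT en].
  by rewrite totient_coprime ?coprime2n // (@totient_prime 2) ?mul1n.
have [m cm nE] := pfactor_coprime (isT : prime 2) n0.
have l0 : (0 < logn 2 n)%N by rewrite lognE n0 dvdn2 en.
have cm' k : coprime m (2 ^ k) by rewrite coprime_sym coprimeXl.
rewrite nE mulnCA -expnS !totient_coprime // !totient_pfactor //= !mul1n.
by rewrite mulnCA -expnS prednK.
Qed.

Lemma comp_map_ratr (q : {poly rat}) (z : algC) n :
  root (map_poly ratr (q \Po 'X^n)) z = root (map_poly ratr q) (z ^+ n).
Proof. by rewrite map_comp_poly map_polyXn root_comp hornerXn. Qed.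

Lemma PhiQ_double_dvd n : (0 < n)%N -> PhiQ (2 * n) %| PhiQ n \Po 'X^2.
Proof.
move=> n0; have n20 : (0 < 2 * n)%N by rewrite muln_gt0.
have [z pz] := C_prim_root_exists n20.
rewrite -(PhiQ_dvd _ pz) comp_map_ratr root_PhiQ //.
have := dvdn_prim_root pz (dvdn_mull 2 (dvdnn n)).
by rewrite mulnK.
Qed.

Lemma PhiQ_comp_X2_even n : (0 < n)%N -> ~~ odd n ->
  PhiQ n \Po 'X^2 = PhiQ (2 * n).
Proof.
move=> n0 en; apply/eqP; rewrite -eqp_monic ?PhiQ_monic ?monic_comp_Xn ?PhiQ_monic //.
rewrite eqp_sym -dvdp_size_eqp ?PhiQ_double_dvd //.
have nz : PhiQ n \Po 'X^2 != 0 by rewrite comp_Xn_eq0 // monic_neq0 ?PhiQ_monic.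
have := size_comp_Xn (PhiQ n) 2; rewrite !size_PhiQ totient_double // (negPf en).
by size_lia.
Qed.

(** Both factors divide the left side and are coprime; the degrees agree because
    [totient (2 * n) = totient n]. This identity makes Phi_d, [d] odd, behave like an infinite
    product. *)
Lemma PhiQ_comp_X2_odd n : odd n -> PhiQ n \Po 'X^2 = PhiQ n * PhiQ (2 * n).
Proof.
move=> on; have n0 : (0 < n)%N by case: n on.
have n20 : (0 < 2 * n)%N by rewrite muln_gt0.
apply/eqP; rewrite -eqp_monic ?monicMl ?monic_comp_Xn ?PhiQ_monic //.
have cop : coprimep (PhiQ n) (PhiQ (2 * n)).
  rewrite irreducible_poly_coprime; last exact: PhiQ_irreducible.
  apply/negP => /(irreducible_monic_dvd_eq _ _ _ _).
  move=> /(_ (PhiQ_irreducible n0) (PhiQ_irreducible n20) (PhiQ_monic _) (PhiQ_monic _)).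
  by move=> /PhiQ_inj => /(_ n0 n20); lia.
have dv : PhiQ n * PhiQ (2 * n) %| PhiQ n \Po 'X^2.
  rewrite Gauss_dvdp // PhiQ_double_dvd // andbT.
  have [z pz] := C_prim_root_exists n0.
  rewrite -(PhiQ_dvd _ pz) comp_map_ratr root_PhiQ //.
  by rewrite prim_root_exp_coprime // coprime2n.
rewrite eqp_sym -dvdp_size_eqp //.
have nz : PhiQ n \Po 'X^2 != 0 by rewrite comp_Xn_eq0 // monic_neq0 ?PhiQ_monic.
have := size_comp_Xn (PhiQ n) 2; rewrite size_mul ?monic_neq0 ?PhiQ_monic //.
rewrite !size_PhiQ totient_double // on.
by size_lia.
Qed.

Lemma PhiQ_comp_X2n d k : (0 < d)%N ->
  PhiQ (2 * d) \Po 'X^(2 ^ k) = PhiQ (2 ^ k.+1 * d).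
Proof.
move=> d0; elim: k => [|k IH]; first by rewrite expr1 comp_polyXr.
rewrite expnSr -comp_Xn_mul IH PhiQ_comp_X2_even.
- by rewrite mulnA -expnS.
- by rewrite muln_gt0 expn_gt0.
- by rewrite expnS -mulnA mul2n odd_double.
Qed.

Lemma PhiQ_stable d : (0 < d)%N -> stable (PhiQ (2 * d)).
Proof.
move=> d0 k; rewrite PhiQ_comp_X2n //; apply: PhiQ_irreducible.
by rewrite muln_gt0 expn_gt0.
Qed.

(** * Infinite sequences of splittings *)

(** Multiplying by X - z subtracts [z] times a coefficient from a shifted one, so a bound on the
    coefficients grows by a factor of at most 1 + B. *)
Lemma coef_prod_XsubC_le (R : numDomainType) (s : seq R) (B : R) i : 0 <= B ->
  (forall z, z \in s -> `|z| <= B) ->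
  `|(\prod_(z <- s) ('X - z%:P))`_i| <= (1 + B) ^+ size s.
Proof.
move=> B0; elim: s i => [|z s IH] i Bs /=.
  by rewrite big_nil coef1 expr0; case: (i == 0%N); rewrite ?normr1 ?normr0.
rewrite big_cons mulrBl coefB coefXM coefCM exprS mulrDl mul1r.
have {}IH j := IH j (fun w ws => Bs w (mem_behead (s := z :: s) ws)).
have pos : 0 <= (1 + B) ^+ size s by rewrite exprn_ge0 // addr_ge0.
apply: le_trans (ler_normB _ _) _; apply: lerD.
  by case: (i == 0%N); rewrite ?normr0.
by rewrite normrM; apply: ler_pM => //; apply: Bs; rewrite mem_head.
Qed.

Lemma pigeonhole (T : finType) (f : nat -> T) : exists i j, (i < j)%N /\ f i = f j.
Proof.
apply: contrapT => h; have inj : injective (fun i : 'I_#|T|.+1 => f i).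
  move=> i j fij; apply/val_inj/eqP => /=; case: ltngtP => // lt.
    by case: h; exists i, j.
  by case: h; exists j, i.
by have := leq_card _ inj; rewrite card_ord ltnn.
Qed.

Lemma bounded_int_poly_repeat (P : nat -> {poly int}) (n K : nat) :
  (forall i, size (P i) <= n)%N -> (forall i k, absz ((P i)`_k)%R <= K)%N ->
  exists i j, (i < j)%N /\ P i = P j.
Proof.
move=> Ps PK.
(* Each coefficient is coded by its absolute value, at most [K], and its sign, so that only finitely
   many codes exist. *)
pose f i : {ffun 'I_n -> 'I_K.+1 * bool} :=
  [ffun k : 'I_n => (inord (absz (P i)`_k), (P i)`_k < 0)].
have [i [j [ij /ffunP fij]]] := pigeonhole f; exists i, j; split=> //.
apply/polyP => k; have [kn|nk] := ltnP k n; last first.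
  by rewrite !nth_default // (leq_trans (Ps _)).
have := fij (Ordinal kn); rewrite !ffunE /= => -[/(congr1 val) /=].
by rewrite !inordK ?ltnS // => e1 e2; rewrite [LHS]intEsign e1 e2 -intEsign.
Qed.

Definition int_root (P : {poly int}) (z : algC) : bool := root (map_poly intr P) z.

Lemma int_poly_coef_le (P : {poly int}) (B : algC) i : P != 0 -> 0 <= B ->
  (forall z, int_root P z -> `|z| <= B) ->
  `|(P`_i)%:~R| <= `|(lead_coef P)%:~R| * (1 + B) ^+ (size P).-1.
Proof.
move=> P0 B0 hB; set Q := map_poly intr P : {poly algC}.
have sQ : size Q = size P by rewrite size_map_inj_poly //; apply: intr_inj.
have [s Qs] := closed_field_poly_normal Q.
have lQ : lead_coef Q = (lead_coef P)%:~R.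
  by rewrite lead_coef_map_inj //; apply: intr_inj.
have lQ0 : lead_coef Q != 0 by rewrite lead_coef_eq0 -size_poly_gt0 sQ size_poly_gt0.
have ss : size s = (size P).-1.
  by rewrite -sQ Qs size_scale // size_prod_XsubC.
rewrite -lQ -coef_map /= -/Q [in X in X <= _]Qs coefZ normrM ler_wpM2l // -ss.
apply: coef_prod_XsubC_le => // z zs; apply: hB.
by rewrite /int_root -/Q Qs rootZ // root_prod_XsubC.
Qed.

(* Every root of [P'] is a square root of a root of [P]. *)
Definition graeffe_step (P P' : {poly int}) : Prop :=
  size P' = size P /\ exists r, P \Po 'X^2 = P' * r.

Lemma graeffe_step_root P P' z : graeffe_step P P' ->
  int_root P' z -> int_root P (z ^+ 2).
Proof.
move=> [_ [r e]] rz.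
have : root (map_poly intr (P \Po 'X^2)) z.
  by rewrite e rmorphM /= rootM; apply/orP; left.
by rewrite map_comp_poly map_polyXn root_comp hornerXn.
Qed.

(** Degrees are constant, leading coefficients divide the preceding ones, and roots stay bounded
    because they are iterated square roots; hence all coefficients are bounded. *)
Lemma graeffe_repeat (P : nat -> {poly int}) : P 0%N != 0 ->
  (forall i, graeffe_step (P i) (P i.+1)) -> exists i j, (i < j)%N /\ P i = P j.
Proof.
move=> P0 st.
have sz i : size (P i) = size (P 0%N).
  by elim: i => // i IH; case: (st i) => ->.
have nz i : P i != 0 by rewrite -size_poly_gt0 sz size_poly_gt0.
have lc i : (absz (lead_coef (P i)) <= absz (lead_coef (P 0%N)))%N.
  elim: i => // i IH; apply: leq_trans IH.
  have [_ [r e]] := st i.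
  have := congr1 lead_coef e; rewrite lead_coef_comp ?size_polyXn // lead_coefXn.
  rewrite expr1n mulr1 lead_coefM => ->; rewrite abszM leq_pmulr //.
  rewrite absz_gt0 lead_coef_eq0; apply: contraNneq (nz i) => r0.
  by rewrite -(comp_Xn_eq0 _ (isT : 0 < 2)%N) e r0 mulr0.
have [B [B1 hB]] : exists B : algC, 1 <= B /\ forall z, int_root (P 0%N) z -> `|z| <= B.
  set Q := map_poly intr (P 0%N) : {poly algC}.
  have Q0 : Q != 0.
    by rewrite map_poly_eq0_id0 // intr_eq0 lead_coef_eq0.
  have [s Qs] := closed_field_poly_normal Q.
  (* The summand 1 ensures B >= 1, so that |z|^2 <= B implies |z| <= B. *)
  exists (1 + \sum_(z <- s) `|z|); split.
    by rewrite lerDl sumr_ge0.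
  move=> z; rewrite /int_root -/Q Qs rootZ ?lead_coef_eq0 // root_prod_XsubC => zs.
  rewrite (big_rem z) //= addrCA lerDl addr_ge0 // sumr_ge0 //.
have B0 : 0 <= B by apply: le_trans B1.
have hBi i z : int_root (P i) z -> `|z| <= B.
  elim: i z => [//|i IH] z /(graeffe_step_root (st i))/IH.
  rewrite normrX => h; rewrite real_leNgt ?normr_real ?ger0_real //.
  apply/negP => Bz; have : B < `|z| ^+ 2.
    apply: (lt_le_trans Bz); rewrite expr2 ler_peMl //.
    exact: ltW (le_lt_trans B1 Bz).
  by move=> /(le_lt_trans h); rewrite ltxx.
set C := `|(lead_coef (P 0%N))%:~R| * (1 + B) ^+ (size (P 0%N)).-1.
have C0 : 0 <= C by rewrite mulr_ge0 // exprn_ge0 // addr_ge0.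
apply: (@bounded_int_poly_repeat P (size (P 0%N)) (Num.bound C)) => [i|i k].
  by rewrite sz.
have := int_poly_coef_le k (nz i) B0 (@hBi i); rewrite sz => h.
rewrite -(ler_nat algC) natr_absz intr_norm.
apply: le_trans h _; apply: le_trans (ltW (archi_boundP C0)).
apply: ler_wpM2r; first by rewrite exprn_ge0 // addr_ge0.
by rewrite -!intr_norm -!natr_absz ler_nat.
Qed.

(** When the sequence returns to [P i], the power map with exponent N = 2^(j-i) sends the finite set
    of roots of [P i] into itself, so two of the iterates z^(N^k) coincide. *)
Lemma repeat_root_of_unity (P : nat -> {poly int}) i j z :
  (forall i, graeffe_step (P i) (P i.+1)) -> (i < j)%N -> P i = P j -> P i != 0 ->
  z != 0 -> int_root (P i) z -> exists2 m, (0 < m)%N & m.-primitive_root z.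
Proof.
move=> st ij e P0 z0 rz.
have down k w : int_root (P (i + k)%N) w -> int_root (P i) (w ^+ (2 ^ k)).
  elim: k w => [|k IH] w; first by rewrite addn0 expr1.
  by rewrite addnS => /(graeffe_step_root (st _))/IH; rewrite -exprM -expnS.
have [N [N1 rN]] : exists N, (1 < N)%N /\
    forall w, int_root (P i) w -> int_root (P i) (w ^+ N).
  exists (2 ^ (j - i))%N; split; first by rewrite -{1}(expn0 2) ltn_exp2l // subn_gt0.
  by move=> w rw; apply: down; rewrite (subnKC (ltnW ij)) -e; exact: rw.
have it k : int_root (P i) (z ^+ (N ^ k)).
  elim: k => [|k IH]; first by rewrite expn0 expr1.
  by rewrite expnSr exprM; apply: rN.
set Q := map_poly intr (P i) : {poly algC}.
have Q0 : Q != 0 by rewrite map_poly_eq0_id0 // intr_eq0 lead_coef_eq0.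
(* A nonzero polynomial has fewer distinct roots than its size, so [size Q] powers are one too
   many. *)
set s := [seq z ^+ (N ^ k) | k <- iota 0 (size Q)].
have : ~~ uniq s.
  apply/negP => us; have : (size s < size Q)%N.
    apply: max_poly_roots => //; apply/allP => w /mapP[k _ ->]; exact: it.
  by rewrite size_map size_iota ltnn.
move=> /(uniqPn 0)[k [l [kl ls]]]; rewrite size_map size_iota in ls.
rewrite !(nth_map 0%N) ?size_iota ?(ltn_trans kl) // !nth_iota ?(ltn_trans kl) //.
rewrite !add0n => zkl.
have lt : (N ^ k < N ^ l)%N by rewrite ltn_exp2l.
have : z ^+ (N ^ l - N ^ k) = 1.
  by rewrite expfB // zkl divff // expf_neq0.
move=> /prim_order_exists[]; first by rewrite subn_gt0.
by move=> m pm _; exists m => //; apply: prim_order_gt0 pm.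
Qed.

(** After passing to integer polynomials, two of them coincide; a root of the corresponding [q i] is
    a root of unity, and irreducibility makes [q i] cyclotomic up to a scalar. *)
Lemma graeffe_cyclotomic (q : nat -> {poly rat}) :
  (q 0%N).[0] != 0 -> (forall i, irreducible_poly (q i)) ->
  (forall i, size (q i.+1) = size (q i)) -> (forall i, q i.+1 %| q i \Po 'X^2) ->
  exists i d, (0 < d)%N /\ q i %= PhiQ d.
Proof.
move=> q00 irr sq dq.
have q0 i : (q i).[0] != 0.
  elim: i => // i; apply: contraNN => /eqP/rootP/(root_dvdp (dq i)).
  by rewrite rootE horner0_comp_Xn.
(* Gauss's lemma, [dvdpP_rat_int], provides the next integer polynomial as a divisor over the
   integers. The pair records the index, and 0 is a dummy value that makes the choice function
   total. *)
have ex (iP : nat * {poly int}) : exists P' : {poly int},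
    q iP.1 %= map_poly intr iP.2 ->
    q iP.1.+1 %= map_poly intr P' /\ graeffe_step iP.2 P'.
  case: iP => i P /=; have [e|] := pselect (q i %= map_poly intr P); last by exists 0.
  have d : q i.+1 %| map_poly intr (P \Po 'X^2).
    rewrite map_comp_poly map_polyXn; apply: dvdp_trans (dq i) _.
    by rewrite dvdp_comp_Xn // (eqp_dvdl _ e).
  have [P' [a a0 qP'] [r Pr]] := dvdpP_rat_int d.
  have e' : q i.+1 %= map_poly intr P' by rewrite qP' eqp_scale.
  exists P' => _; split=> //; split; last by exists r.
  by rewrite -!size_rat_int_poly -(eqp_size e') -(eqp_size e) sq.
have [nxt hnxt] := choice ex.
have [P0 [a a0 qP0]] := rat_poly_scale (q 0%N).
pose P := fix P i := if i is i'.+1 then nxt (i', P i') else P0.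
have hP i : q i %= map_poly intr (P i).
  elim: i => [|i IH]; last by have [] := hnxt (i, P i) IH.
  by rewrite qP0 /= eqp_scale // invr_eq0 intr_eq0.
have st i : graeffe_step (P i) (P i.+1) by have [] := hnxt (i, P i) (hP i).
have nz i : P i != 0.
  rewrite -size_poly_gt0 -size_rat_int_poly -(eqp_size (hP i)) size_poly_gt0.
  exact: irredp_neq0.
have [i [j [ij e]]] := graeffe_repeat (nz 0%N) st.
have [z rz] : exists z : algC, root (map_poly ratr (q i)) z.
  by apply: closed_rootP; rewrite size_map_poly; case: (irr i); case: size => [|[]].
have z0 : z != 0.
  apply: contraNneq (q0 i) => z0; move: rz; rewrite z0 -(rmorph0 ratr) fmorph_root.
  by rewrite rootE.
have rzP : int_root (P i) z.
  rewrite /int_root -map_ratr_intr; apply: root_dvdp rz.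
  by rewrite dvdp_map (eqp_dvdl _ (hP i)).
have [m m0 pm] := repeat_root_of_unity st ij e (nz i) z0 rzP.
exists i, m; split=> //; rewrite eqp_sym; apply: (apply_irredp (irr i)).
  by rewrite size_PhiQ eqSS -lt0n totient_gt0.
by rewrite -(PhiQ_dvd _ pm).
Qed.

(** * Eventual factorization *)

(** The values [ev n q] of these polynomials are exactly the elements of [S]; see [Sset_ev] and
    [SsetE]. *)
Definition prime_poly (q : {poly rat}) : Prop :=
  [/\ q \is monic, q.[0] != 0 & stable q].

(** The lists [s] and [e] carry multiplicities. The [PhiQ d] with [d] odd are kept apart because
    they split again at every substitution Y -> Y^2. *)
Definition cyclo_factored (p : {poly rat}) : Prop :=
  exists (c : rat) (s : seq {poly rat}) (e : seq nat),
    [/\ c != 0, forall q, q \in s -> prime_poly q, all odd e &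
      p = c *: (\prod_(q <- s) q * \prod_(d <- e) PhiQ d)].

Definition eventually_factored (p : {poly rat}) : Prop :=
  exists k, cyclo_factored (p \Po 'X^(2 ^ k)).

Lemma prime_poly_comp_X2 q : prime_poly q -> prime_poly (q \Po 'X^2).
Proof.
move=> [qm q0 st]; split; rewrite ?monic_comp_Xn ?horner0_comp_Xn // => k.
by rewrite comp_Xn_mul -expnS.
Qed.

Lemma prime_poly_PhiQ d : (0 < d)%N -> prime_poly (PhiQ (2 * d)).
Proof.
by move=> d0; split; rewrite ?PhiQ_monic ?PhiQ_horner0 ?muln_gt0 //; apply: PhiQ_stable.
Qed.

Lemma cyclo_factoredM p q :
  cyclo_factored p -> cyclo_factored q -> cyclo_factored (p * q).
Proof.
move=> [c [s [e [c0 sP eo ->]]]] [c' [s' [e' [c'0 sP' eo' ->]]]].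
exists (c * c'), (s ++ s'), (e ++ e'); split; rewrite ?mulf_neq0 //.
- by move=> r; rewrite mem_cat => /orP[/sP|/sP'].
- by rewrite all_cat eo.
- by rewrite !big_cat -scalerAl -scalerAr scalerA mulrACA.
Qed.

Lemma cyclo_factored_const c : c != 0 -> cyclo_factored c%:P.
Proof. by move=> c0; exists c, [::], [::]; rewrite !big_nil mulr1 alg_polyC. Qed.

Lemma cyclo_factored_prime q : prime_poly q -> cyclo_factored q.
Proof.
move=> qP; exists 1, [:: q], [::]; split=> //.
  by move=> r; rewrite inE => /eqP->.
by rewrite big_seq1 big_nil mulr1 scale1r.
Qed.

Lemma cyclo_factored_PhiQ d : odd d -> cyclo_factored (PhiQ d).
Proof.
move=> od; exists 1, [::], [:: d]; split=> //; rewrite ?oner_neq0 //= ?od //.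
by rewrite big_seq1 big_nil mul1r scale1r.
Qed.

Lemma cyclo_factored_prod (I : eqType) (s : seq I) (F : I -> {poly rat}) :
  (forall i, i \in s -> cyclo_factored (F i)) -> cyclo_factored (\prod_(i <- s) F i).
Proof.
elim: s => [|i s IH] h; first by rewrite big_nil; apply: cyclo_factored_const.
rewrite big_cons; apply: cyclo_factoredM; first by apply: h; rewrite mem_head.
by apply: IH => j js; apply: h; rewrite inE js orbT.
Qed.

(** Each [PhiQ d] with [d] odd reproduces itself and contributes the new prime factor
    [PhiQ (2 * d)]. *)
Lemma cyclo_factored_comp_X2 p : cyclo_factored p -> cyclo_factored (p \Po 'X^2).
Proof.
move=> [c [s [e [c0 sP /allP eo ->]]]].
rewrite comp_polyZ -mul_polyC comp_polyM !rmorph_prod.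
apply: cyclo_factoredM; first exact: cyclo_factored_const.
apply: cyclo_factoredM; apply: cyclo_factored_prod.
  by move=> q /sP qP; apply/cyclo_factored_prime/prime_poly_comp_X2.
move=> d /eo od /=; rewrite PhiQ_comp_X2_odd //; apply: cyclo_factoredM.
  exact: cyclo_factored_PhiQ.
by apply/cyclo_factored_prime/prime_poly_PhiQ; case: d od.
Qed.

Lemma cyclo_factored_comp_X2n p k k' : (k <= k')%N ->
  cyclo_factored (p \Po 'X^(2 ^ k)) -> cyclo_factored (p \Po 'X^(2 ^ k')).
Proof.
move=> /subnK <- h; elim: (k' - k)%N => [//|m IH].
by rewrite addSn expnSr -comp_Xn_mul; apply: cyclo_factored_comp_X2.
Qed.

Lemma eventually_factoredM p q :
  eventually_factored p -> eventually_factored q -> eventually_factored (p * q).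
Proof.
move=> [k hk] [l hl]; exists (maxn k l); rewrite comp_polyM; apply: cyclo_factoredM.
  by apply: cyclo_factored_comp_X2n hk; rewrite leq_maxl.
by apply: cyclo_factored_comp_X2n hl; rewrite leq_maxr.
Qed.

Lemma cyclo_factored_eventually_factored p : cyclo_factored p -> eventually_factored p.
Proof. by move=> h; exists 0%N; rewrite expr1 comp_polyXr. Qed.

Lemma eventually_factored_eqp p q :
  p %= q -> eventually_factored p -> eventually_factored q.
Proof.
rewrite eqp_sym => /eqpf_eq[c c0 ->] h; rewrite -mul_polyC; apply: eventually_factoredM => //.
exact/cyclo_factored_eventually_factored/cyclo_factored_const.
Qed.

Lemma eventually_factored_comp_X2n p k :
  eventually_factored (p \Po 'X^(2 ^ k)) -> eventually_factored p.
Proof. by move=> [l]; rewrite comp_Xn_mul -expnD => h; exists (k + l)%N. Qed.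

Lemma eventually_factored_stable q : q.[0] != 0 -> stable q -> eventually_factored q.
Proof.
move=> q0 st; have q_n0 : q != 0 by apply: contraNneq q0 => ->; rewrite horner0.
have l0 : lead_coef q != 0 by rewrite lead_coef_eq0.
have e : (lead_coef q)^-1 *: q %= q by rewrite eqp_scale // invr_eq0.
apply: (eventually_factored_eqp e).
apply/cyclo_factored_eventually_factored/cyclo_factored_prime; split.
- by rewrite monicE lead_coefZ mulVf.
- by rewrite hornerZ mulf_neq0 // invr_eq0.
move=> k; rewrite comp_polyZ; have [sz irr] := st k.
have e' : (lead_coef q)^-1 *: (q \Po 'X^(2 ^ k)) %= q \Po 'X^(2 ^ k).
  by rewrite eqp_scale // invr_eq0.
split; first by rewrite (eqp_size e').
move=> r sr; rewrite (eqp_dvdr _ e') (eqp_rtrans e').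
exact: irr.
Qed.

Lemma eventually_factored_PhiQ d : (0 < d)%N -> eventually_factored (PhiQ d).
Proof.
move=> d0; apply: cyclo_factored_eventually_factored; have [od|ed] := boolP (odd d).
  exact: cyclo_factored_PhiQ.
rewrite -[d]odd_double_half (negPf ed) add0n -mul2n.
by apply/cyclo_factored_prime/prime_poly_PhiQ; lia.
Qed.

(** The supposed counterexamples, shown not to exist in [irreducible_eventually_factored]. *)
Definition unfactorable (q : {poly rat}) : Prop :=
  [/\ irreducible_poly q, q.[0] != 0 & ~ eventually_factored q].

Lemma irreducible_comp_oppX (F : fieldType) (t : {poly F}) :
  irreducible_poly t -> irreducible_poly (t \Po - 'X).
Proof.
move=> [st irr]; split; first by rewrite size_comp_oppX.
move=> q sq; rewrite -dvdp_comp_oppX => /irr.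
rewrite size_comp_oppX => /(_ sq)/andP[d1 d2].
by rewrite /eqp -dvdp_comp_oppX d1 dvdp_comp_oppX d2.
Qed.

(** If both factors t and t(-X) of q(X^2) were eventually factored, so would be q; hence one of them
    is again a counterexample. *)
Lemma unfactorable_split q : unfactorable q -> ~ irreducible_poly (q \Po 'X^2) ->
  exists t, [/\ unfactorable t, size t = size q & t %| q \Po 'X^2].
Proof.
move=> [irr q0 ng] nirr; have [t [e tirr st]] := comp_X2_split irr q0 nirr.
have Q0 : (q \Po 'X^2).[0] != 0 by rewrite horner0_comp_Xn.
have nz t' : t' %| q \Po 'X^2 -> t'.[0] != 0.
  by move=> d; apply: contraNN Q0 => /(root_dvdp d).
have d1 : t %| q \Po 'X^2 by rewrite (eqp_dvdr _ e) dvdp_mulr.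
have d2 : t \Po - 'X %| q \Po 'X^2 by rewrite (eqp_dvdr _ e) dvdp_mull.
have [g1|b1] := pselect (eventually_factored t); last first.
  by exists t; split=> //; split=> //; apply: nz.
have [g2|b2] := pselect (eventually_factored (t \Po - 'X)).
  case: ng; apply: (@eventually_factored_comp_X2n _ 1); rewrite expn1.
  by rewrite eqp_sym in e; apply: (eventually_factored_eqp e); apply: eventually_factoredM.
exists (t \Po - 'X); split; rewrite ?size_comp_oppX //.
by split=> //; [apply: irreducible_comp_oppX | apply: nz].
Qed.

(** Iterated splitting inside [P] gives a sequence of constant degree to which [graeffe_cyclotomic]
    applies, yet cyclotomic polynomials are eventually factored. The predicate [P] allows two uses
    in succession. *)
Lemma no_unfactorable_family (P : {poly rat} -> Prop) :
  (forall q, P q -> unfactorable q /\ ~ irreducible_poly (q \Po 'X^2)) ->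
  (forall q t, P q -> t %| q \Po 'X^2 -> unfactorable t -> P t) ->
  forall q, ~ P q.
Proof.
move=> Pbad Pdesc q0 Pq0.
have /choice[nxt hnxt] : forall q, exists t, P q ->
    [/\ P t, size t = size q & t %| q \Po 'X^2].
  move=> q; have [Pq|nPq] := pselect (P q); last by exists 0.
  have [bq nirr] := Pbad q Pq; have [t [bt st tq]] := unfactorable_split bq nirr.
  by exists t => _; split=> //; apply: Pdesc tq bt.
pose q i := iter i nxt q0.
have Pq i : P (q i) by elim: i => [//|i IH]; have [] := hnxt (q i) IH.
have [||||i [d [d0 e]]] := @graeffe_cyclotomic q.
- by have [[]] := Pbad _ Pq0.
- by move=> i; have [[]] := Pbad _ (Pq i).
- by move=> i; have [] := hnxt _ (Pq i).
- by move=> i; have [] := hnxt _ (Pq i).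
have [[_ _ ng] _] := Pbad _ (Pq i); apply: ng; rewrite eqp_sym in e.
exact: eventually_factored_eqp e (eventually_factored_PhiQ d0).
Qed.

Lemma irreducible_eventually_factored q :
  irreducible_poly q -> q.[0] != 0 -> eventually_factored q.
Proof.
have unst r : unfactorable r -> ~ stable r.
  by move=> [_ r0 ng] st; apply/ng/eventually_factored_stable.
(* With a square root of -1, irreducibility of r(X^2) would already make [r] stable. *)
have step1 : forall r, ~ (unfactorable r /\ has_sqrtN1 r).
  apply: no_unfactorable_family => [r [br ir]|r t [br ir] tr bt].
    split=> // irr; apply: (unst r br); case: br => _ r0 _.
    exact: has_sqrtN1_stable.
  by split=> //; apply: has_sqrtN1_dvd_comp tr.
(* In general, irreducibility of r(X^2) leads to some r(X^(2^k)) that is a counterexample with a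
   square root of -1, excluded by the first round. *)
have step2 : forall r, ~ unfactorable r.
  apply: no_unfactorable_family => // r br; split=> // irr; have [_ r0 ng] := br.
  have [k [ik irrk]] := unstable_reducible r0 irr (unst r br).
  apply: (step1 (r \Po 'X^(2 ^ k))); split=> //; split=> //.
    by rewrite horner0_comp_Xn // expn_gt0.
  by move=> /eventually_factored_comp_X2n.
by move=> irr q0; apply: contrapT => ng; apply: (step2 q).
Qed.

Lemma horner0_eventually_factored (p : {poly rat}) : p.[0] != 0 -> eventually_factored p.
Proof.
have [n] := ubnP (size p); elim: n p => // n IH p; rewrite ltnS => sp p0.
have p_n0 : p != 0 by apply: contraNneq p0 => ->; rewrite horner0.
have [s1|s1] := leqP (size p) 1.
  rewrite (size1_polyC s1); apply/cyclo_factored_eventually_factored/cyclo_factored_const.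
  by rewrite -horner_coef0.
have [/irreducible_eventually_factored|/(not_irreducible s1)] :=
  pselect (irreducible_poly p); first exact.
move=> [q [sq /dvdpP[r e]] nqp].
have q_n0 : q != 0 by apply: contraNneq p_n0 => q0; rewrite e q0 mulr0.
have r_n0 : r != 0 by apply: contraNneq p_n0 => r0; rewrite e r0 mul0r.
have sr : size r != 1%N.
  apply: contra nqp => /eqP/eqP/size_poly1P[c c0 rc].
  by rewrite e rc mul_polyC eqp_sym eqp_scale.
have spE : size p = (size r + size q).-1 by rewrite e size_mul.
move: p0; rewrite e hornerM mulf_eq0 negb_or => /andP[r0 q0].
by apply: eventually_factoredM; apply: IH => //; move: sp spE; size_lia.
Qed.

(** * The ring D *)
Lemma count_flatten_nseq (I : Type) (T : eqType) (P : pred T) (b : I -> nat)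
    (t : I -> T) (r : seq I) :
  count P (flatten [seq nseq (b i) (t i) | i <- r]) = (\sum_(i <- r) b i * P (t i))%N.
Proof.
elim: r => [|i r IH]; first by rewrite big_nil.
by rewrite big_cons /= count_cat IH count_nseq mulnC.
Qed.

Section DyadicRing.
Variables (L : fieldType) (iota : {rmorphism rat -> L}) (x : nat -> L).
Hypothesis hx : dyadic_roots iota x.

Local Notation ev := (ev iota x).
Local Notation D := (Dring iota x).
Local Notation S := (Sset iota x).
Local Notation Phi2 := (Phi2 iota x).

Lemma x_expn n m : x (n + m)%N ^+ (2 ^ m) = x n.
Proof.
elim: m => [|m IH]; first by rewrite addn0 expr1.
by rewrite addnS expnS exprM (hx.2 _) IH.
Qed.

Lemma algebraic_expr (y : L) n : algebraicOver iota y -> algebraicOver iota (y ^+ n).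
Proof.
move=> ay; elim: n => [|n IH]; first by rewrite expr0; apply: algebraic1.
by rewrite exprS; apply: algebraic_mul.
Qed.

Lemma x_transcendental n : ~ algebraicOver iota (x n).
Proof. by move=> a; apply: hx.1; rewrite -(x_expn 0 n); apply: algebraic_expr. Qed.

Lemma x_neq0 n : x n != 0.
Proof.
by apply/negP => /eqP x0; apply: (@x_transcendental n); rewrite x0; apply: algebraic0.
Qed.

Lemma evM n p q : ev n (p * q) = ev n p * ev n q.
Proof. by rewrite /Defs.ev rmorphM hornerM. Qed.

Lemma ev1 n : ev n 1 = 1.
Proof. by rewrite /Defs.ev rmorph1 hornerE. Qed.

Lemma evXn n k : ev n 'X^k = x n ^+ k.
Proof. by rewrite /Defs.ev map_polyXn hornerXn. Qed.

Lemma ev_comp n m p : ev (n + m)%N (p \Po 'X^(2 ^ m)) = ev n p.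
Proof. by rewrite /Defs.ev map_comp_poly map_polyXn horner_comp hornerXn x_expn. Qed.

Lemma ev_comp_le n N p : (n <= N)%N -> ev N (p \Po 'X^(2 ^ (N - n))) = ev n p.
Proof. by move=> nN; rewrite -[in LHS](subnKC nN) addKn ev_comp. Qed.

Lemma ev_eq0 n p : (ev n p == 0) = (p == 0).
Proof.
apply/idP/idP => [p0|/eqP->]; last by rewrite /Defs.ev rmorph0 horner0.
by apply/negPn/negP => np; apply: (@x_transcendental n); exists p.
Qed.

Lemma ev_inj n : injective (ev n).
Proof.
move=> p q e; apply/eqP; rewrite -subr_eq0 -(ev_eq0 n) /Defs.ev rmorphB hornerD hornerN.
by rewrite subr_eq0 -/(ev n p) e.
Qed.

Lemma D_ev n p : D (ev n p).
Proof. by exists n, p, 0%N; rewrite expr0 divr1. Qed.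

Lemma D1 : D 1.
Proof. by rewrite -(ev1 0); apply: D_ev. Qed.

Lemma unit1 : unit_in D 1.
Proof. by split; [|exists 1; rewrite ?mulr1 //]; apply: D1. Qed.

(** This brings finitely many elements of [D] to a common level [N]. *)
Lemma D_level f : D f -> exists n, forall N, (n <= N)%N ->
  exists p k, f = ev N p / x N ^+ k.
Proof.
move=> [n [p [k ->]]]; exists n => N nN.
exists (p \Po 'X^(2 ^ (N - n))), (2 ^ (N - n) * k)%N.
by rewrite ev_comp_le // exprM -(x_expn n (N - n)) subnKC.
Qed.

Lemma D_mul f g : D f -> D g -> D (f * g).
Proof.
move=> /D_level[m fm] /D_level[n gn].
have [p [k ->]] := fm _ (leq_maxl m n); have [q [l ->]] := gn _ (leq_maxr m n).
exists (maxn m n), (p * q), (k + l)%N; rewrite evM exprD.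
by rewrite invfM mulrACA.
Qed.

Lemma D_exp f k : D f -> D (f ^+ k).
Proof.
move=> Df; elim: k => [|k IH]; first by rewrite expr0; apply: D1.
by rewrite exprS; apply: D_mul.
Qed.

Lemma D_xn n k : D (x n ^+ k).
Proof. by rewrite -evXn; apply: D_ev. Qed.

Lemma D_xnV n k : D (x n ^+ k)^-1.
Proof. by exists n, 1, k; rewrite ev1 mul1r. Qed.

Lemma divides_trans f g h : divides D f g -> divides D g h -> divides D f h.
Proof.
move=> [a Da ->] [b Db ->]; exists (a * b); first exact: D_mul.
by rewrite mulrA.
Qed.

Lemma divides_mulr f g h : D h -> divides D f g -> divides D f (g * h).
Proof. by move=> Dh [a Da ->]; exists (a * h); [apply: D_mul | rewrite mulrA]. Qed.

Lemma divides_mulr_xn f g n k : divides D f (g / x n ^+ k) <-> divides D f g.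
Proof.
split=> [/(divides_mulr (D_xn n k))|]; last by apply/divides_mulr/D_xnV.
by rewrite mulfVK // expf_neq0 ?x_neq0.
Qed.

Lemma coprimep_Xn (F : fieldType) (p : {poly F}) k : p.[0] != 0 -> coprimep p 'X^k.
Proof. by move=> p0; apply/coprimep_expr/coprimep_X. Qed.

(** At a common level the quotient only has a power of X as denominator, which is coprime to [p]
    because p(0) <> 0; [dvdp_comp_Xn] then returns to level [n]. *)
Lemma divides_ev n p q : p.[0] != 0 -> divides D (ev n p) (ev n q) <-> p %| q.
Proof.
move=> p0; split; last first.
  by move=> /dvdpP[r ->]; exists (ev n r); [apply: D_ev | rewrite evM mulrC].
move=> [h /D_level[m hm] e].
have [r [k hr]] := hm _ (leq_maxr n m); set N := maxn n m in hr.
have nN : (n <= N)%N by apply: leq_maxl.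
rewrite -(ev_comp_le p nN) -(ev_comp_le q nN) hr in e.
set a := (2 ^ (N - n))%N in e; have a0 : (0 < a)%N by rewrite expn_gt0.
rewrite -(@dvdp_comp_Xn _ _ _ a) //.
have {}e : (q \Po 'X^a) * 'X^k = (p \Po 'X^a) * r.
  by apply: (@ev_inj N); rewrite !evM e evXn mulrA mulfVK // expf_neq0 ?x_neq0.
have : p \Po 'X^a %| (q \Po 'X^a) * 'X^k by rewrite e dvdp_mulr.
by rewrite Gauss_dvdpl // coprimep_Xn // horner0_comp_Xn.
Qed.

Lemma prime_poly_comp_X2n q k : prime_poly q -> prime_poly (q \Po 'X^(2 ^ k)).
Proof.
move=> qP; elim: k => [|k IH]; first by rewrite expr1 comp_polyXr.
by rewrite expnSr -comp_Xn_mul; apply: prime_poly_comp_X2.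
Qed.

Lemma prime_poly_irreducible q : prime_poly q -> irreducible_poly q.
Proof. by move=> [_ _ /(_ 0%N)]; rewrite expr1 comp_polyXr. Qed.

(** Primality concerns two elements of [D] at a time; at a level common to both, the substituted [q]
    is still irreducible, by stability. *)
Lemma Sset_ev n q : prime_poly q -> S (ev n q).
Proof.
move=> qP; have [qm q0 _] := qP; have qirr := prime_poly_irreducible qP.
split; first by exists n, q.
split; rewrite ?ev_eq0 ?irredp_neq0 //; first exact: D_ev.
  move=> [_]; rewrite -(ev1 n) divides_ev // dvdp1.
  by case: qirr => [s _] /eqP s1; rewrite s1 in s.
move=> f g /D_level[i fi] /D_level[j gj].
set N := maxn n (maxn i j); have nN : (n <= N)%N by rewrite leq_maxl.
have [|f1 [k ->]] := fi N; first by rewrite /N; lia.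
have [|g1 [l ->]] := gj N; first by rewrite /N; lia.
rewrite mulrACA -invfM -exprD !divides_mulr_xn -evM -(ev_comp_le q nN).
have q'P := prime_poly_comp_X2n (N - n) qP; have [_ q'0 _] := q'P.
by rewrite !divides_ev // => /(irreducible_dvdpM (prime_poly_irreducible q'P))/orP.
Qed.

Lemma SsetE p : S p -> exists n q, prime_poly q /\ p = ev n q.
Proof.
move=> [[n [q [qm q0 pE]]] [_ p_n0 nu pr]]; exists n, q; split=> //; split=> // k.
set Q := q \Po 'X^(2 ^ k); have Qm : Q \is monic by rewrite monic_comp_Xn // expn_gt0.
have Q0 : Q.[0] != 0 by rewrite horner0_comp_Xn // expn_gt0.
have pQ : p = ev (n + k)%N Q by rewrite ev_comp.
have Q_n0 : Q != 0 by rewrite monic_neq0.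
have sQ : (1 < size Q)%N.
  rewrite ltnNge; apply/negP => s1; apply: nu; split; first by rewrite pE; apply: D_ev.
  rewrite pQ -(ev1 (n + k)); apply/divides_ev => //.
  by rewrite dvdp1 eqn_leq s1 size_poly_gt0.
split=> // r sr rQ; have /dvdpP[s e] := rQ.
have s_n0 : s != 0 by apply: contraNneq Q_n0 => s0; rewrite e s0 mul0r.
have r_n0 : r != 0 by apply: contraNneq Q_n0 => r0; rewrite e r0 mulr0.
(* Primality makes [Q] divide [s] or [r]; the first is impossible for reasons of degree, since [r]
   is not constant. *)
have : divides D p (ev (n + k) s * ev (n + k) r).
  by exists 1; [apply: D1 | rewrite mulr1 -evM -e].
move=> /(pr _ _ (D_ev _ _) (D_ev _ _)); rewrite pQ !divides_ev // => -[] Qd.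
  have := dvdp_leq s_n0 Qd; have : size Q = (size s + size r).-1 by rewrite e size_mul.
  by size_lia.
by rewrite /eqp rQ.
Qed.

Lemma Sset_level p : S p -> exists n, forall N, (n <= N)%N ->
  exists2 q, prime_poly q & p = ev N q.
Proof.
move=> /SsetE[n [q [qP ->]]]; exists n => N nN.
exists (q \Po 'X^(2 ^ (N - n))); first exact: prime_poly_comp_X2n.
by rewrite ev_comp_le.
Qed.

Lemma Sset_D p : S p -> D p.
Proof. by case=> _ []. Qed.

(** * Valuations at the primes of S *)

Definition exact_pow (p : L) (k : nat) (f : L) : Prop :=
  divides D (p ^+ k) f /\ ~ divides D (p ^+ k.+1) f.

Lemma exact_pow0 p f : D f -> ~ divides D p f -> exact_pow p 0 f.
Proof. by move=> Df nd; split; [exists f; rewrite ?mul1r | rewrite expr1]. Qed.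

Lemma exact_pow_uniq p k l f : D p -> exact_pow p k f -> exact_pow p l f -> k = l.
Proof.
move=> Dp.
suff le i j : exact_pow p i f -> exact_pow p j f -> (i <= j)%N.
  by move=> hk hl; apply/eqP; rewrite eqn_leq !le.
move=> [d _] [_ nd]; rewrite leqNgt; apply/negP => ji; apply: nd.
apply: divides_trans d; exists (p ^+ (i - j.+1)); first exact: D_exp.
by rewrite -exprD subnKC.
Qed.

(** If one more power of [p] divided the product, then [p] would divide the product of the two
    cofactors, hence one of them. *)
Lemma exact_powM p k l f g : S p ->
  exact_pow p k f -> exact_pow p l g -> exact_pow p (k + l) (f * g).
Proof.
move=> [_ [Dp p0 _ pr]] [[a Da fE] nf] [[b Db gE] ng]; split.
  by exists (a * b); [apply: D_mul | rewrite fE gE exprD mulrACA].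
have pow c i h : h = p ^+ i * c -> divides D p c -> divides D (p ^+ i.+1) h.
  by move=> -> [d Dd ->]; exists d => //; rewrite exprSr mulrA.
move=> [c Dc e]; have : divides D p (a * b).
  exists c => //; apply: (mulfI (expf_neq0 (k + l) p0)).
  by rewrite [RHS]mulrA -exprSr -e fE gE exprD mulrACA.
by move=> /(pr _ _ Da Db)[/(pow _ _ _ fE)|/(pow _ _ _ gE)].
Qed.

Lemma exact_pow_unit p u : S p -> unit_in D u -> exact_pow p 0 u.
Proof.
move=> [_ [Dp _ nu _]] [Du ud]; apply: exact_pow0 => // d; apply: nu.
by split=> //; apply: divides_trans ud.
Qed.

Lemma divides_Sset p q : S p -> S q -> divides D p q -> p = q.
Proof.
move=> /Sset_level[m pm] /Sset_level[n qn].
have [p1 p1P ->] := pm _ (leq_maxl m n); have [q1 q1P ->] := qn _ (leq_maxr m n).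
have [m1 p10 _] := p1P; have [m2 _ _] := q1P.
rewrite divides_ev // => d; congr Defs.ev.
by apply: irreducible_monic_dvd_eq => //; apply: prime_poly_irreducible.
Qed.

Lemma exact_pow_Sset p q : S p -> S q -> exact_pow p (p == q) q.
Proof.
move=> Sp Sq; have [e|npq] := eqVneq p q; last first.
  apply: exact_pow0; first exact: Sset_D.
  by move=> /(divides_Sset Sp Sq)/eqP; rewrite (negPf npq).
rewrite -{}e; have [_ [Dp p0 nu _]] := Sp; split.
  by exists 1; [apply: D1 | rewrite mulr1].
move=> [c Dc e]; apply: nu; split=> //; exists c => //.
by apply: (mulfI p0); rewrite mulr1 mulrA -expr2.
Qed.

(** * The elements Phi_d(X^(1/2^i)) for odd d *)

Definition Phi1 (d i : nat) : L := ev i (PhiQ d).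

Lemma Phi2_Sset d i : (0 < d)%N -> S (Phi2 d i).
Proof. by move=> d0; apply/Sset_ev/prime_poly_PhiQ. Qed.

(** One step of the telescoping: a single prime is peeled off [Phi1 d i]. *)
Lemma Phi1_step d i : odd d -> Phi1 d i = Phi1 d i.+1 * Phi2 d i.+1.
Proof.
move=> od; rewrite /Phi1 /Defs.Phi2 -evM -PhiQ_comp_X2_odd //.
by rewrite -{1}(ev_comp i 1) addn1.
Qed.

(** For i <= j, level [j] turns the equation into 2^(j-i) d = d', and [d'] is odd. *)
Lemma Phi2_inj d d' i j : odd d -> odd d' -> Phi2 d i = Phi2 d' j -> d = d' /\ i = j.
Proof.
wlog ij : d d' i j / (i <= j)%N.
  move=> h od od' e; have [ij|/ltnW ji] := leqP i j; first exact: h.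
  by have [-> ->] := h _ _ _ _ ji od' od (esym e).
move=> od od'; have d0 : (0 < d)%N by case: d od.
have d'0 : (0 < d')%N by case: d' od'.
rewrite /Defs.Phi2 -(ev_comp_le _ ij) => /ev_inj.
rewrite [LHS](PhiQ_comp_X2n _ d0) => /PhiQ_inj.
rewrite !muln_gt0 expn_gt0 d0 d'0 => /(_ isT isT).
rewrite expnS -mulnA => /eqP; rewrite eqn_pmul2l // => /eqP e.
have ji : (j - i = 0)%N.
  by case: (j - i)%N e => // k e; move: od'; rewrite -e expnS -mulnA mul2n odd_double.
by move: e; rewrite ji mul1n => ->; split=> //; lia.
Qed.

(* The valuation at the prime [p] of [Phi_d(X^(1/2^N))]. *)
Definition above (N d : nat) (p : L) : bool := `[< exists2 i, (N < i)%N & p = Phi2 d i >].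

Lemma aboveS N d p : odd d -> (above N d p = above N.+1 d p + (p == Phi2 d N.+1) :> nat)%N.
Proof.
move=> od; rewrite /above; case: (asboolP (exists2 i, (N.+1 < i)%N & _)) => [[i Ni pE]|nex].
  have -> : p == Phi2 d N.+1 = false.
    by apply/eqP => e; rewrite e in pE; have [_] := Phi2_inj od od pE; lia.
  by rewrite asboolT //; exists i => //; apply: ltnW.
case: eqP => [pE|nE]; first by rewrite asboolT //; exists N.+1.
rewrite asboolF // => -[i]; rewrite leq_eqVlt => /orP[/eqP<- //|Ni pE].
by apply: nex; exists i.
Qed.

(** At high levels [p] does not divide [Phi1 d K] and is not [above]; going down, [Phi1_step] and
    [aboveS] change both sides in the same way. *)
Lemma exact_pow_Phi1 p d N : S p -> odd d -> exact_pow p (above N d p) (Phi1 d N).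
Proof.
move=> Sp od; have d0 : (0 < d)%N by case: d od.
have [M Mp] : exists M, forall i, p = Phi2 d i -> (i <= M)%N.
  have [[i pE]|nex] := pselect (exists i, p = Phi2 d i); last first.
    by exists 0%N => i pE; case: nex; exists i.
  by exists i => j; rewrite pE => /(Phi2_inj od od)[_ ->].
have [n np] := Sset_level Sp.
have base K : (M <= K)%N -> (n <= K)%N -> exact_pow p (above K d p) (Phi1 d K).
  move=> MK nK; have -> : above K d p = false.
    by apply/asboolP => -[i Ki /Mp]; lia.
  apply: exact_pow0; first exact: D_ev.
  have [q qP ->] := np K nK; have [qm q0 st] := qP.
  rewrite divides_ev // => /(irreducible_monic_dvd_eq _ _ _ _) qd.
  have {qd} qE : q = PhiQ d.
    by apply: qd; rewrite ?PhiQ_monic //; [apply: prime_poly_irreducible | apply: PhiQ_irreducible].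
  (* A prime dividing [Phi1 d K] would come from [PhiQ d] itself, which is not stable because it
     splits under X -> X^2. *)
  have [_ /(_ (PhiQ d))] := st 1%N; rewrite qE expn1 PhiQ_comp_X2_odd // dvdp_mulr //.
  rewrite size_PhiQ eqSS -lt0n totient_gt0 d0 => /(_ isT isT)/eqp_size.
  have P0 k : PhiQ k != 0 by rewrite monic_neq0 // PhiQ_monic.
  rewrite size_mul // !size_PhiQ.
  by have := totient_gt0 (2 * d); rewrite muln_gt0 d0; lia.
have [K leK] : exists K, (M <= N + K)%N /\ (n <= N + K)%N by exists (M + n)%N; lia.
elim: K N leK => [|K IH] N [MN nN]; first by apply: base; lia.
rewrite Phi1_step // aboveS //; apply: exact_powM => //.
  by apply: IH; lia.
by apply: exact_pow_Sset => //; apply: Phi2_Sset.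
Qed.

(** * Factorization of the elements of D *)

Definition cyclo_prod (N : nat) (s : seq L) (e : seq nat) : L :=
  \prod_(p <- s) p * \prod_(d <- e) Phi1 d N.

Definition cyclo_val (N : nat) (s : seq L) (e : seq nat) (p : L) : nat :=
  (count_mem p s + count (fun d => above N d p) e)%N.

Lemma exact_pow_cyclo_prod N s e p : S p -> (forall q, q \in s -> S q) -> all odd e ->
  exact_pow p (cyclo_val N s e p) (cyclo_prod N s e).
Proof.
move=> Sp Ss oe; apply: exact_powM => //.
  elim: s Ss => [|q s IH] Ss /=.
    by rewrite big_nil; apply: exact_pow_unit => //; apply: unit1.
  rewrite big_cons eq_sym; apply: exact_powM => //.
    by apply: exact_pow_Sset => //; apply: Ss; rewrite mem_head.
  by apply: IH => r rs; apply: Ss; rewrite inE rs orbT.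
elim: e oe => [|d e IH] /=.
  by rewrite big_nil => _; apply: exact_pow_unit => //; apply: unit1.
move=> /andP[od oe]; rewrite big_cons; apply: exact_powM => //; last exact: IH.
exact: exact_pow_Phi1.
Qed.

Definition factored (N : nat) (f : L) : Prop := exists u s e,
  [/\ unit_in D u, forall q, q \in s -> S q, all odd e & f = u * cyclo_prod N s e].

(** Raising the level moves one prime [Phi2 d N.+1] for each entry [d] of [e] into [s]; thus two
    elements can be compared at a common level. *)
Lemma factoredS N f : factored N f -> factored N.+1 f.
Proof.
move=> [u [s [e [uu Ss oe ->]]]]; exists u, (s ++ [seq Phi2 d N.+1 | d <- e]), e; split=> //.
  move=> q; rewrite mem_cat => /orP[/Ss //|/mapP[d /(allP oe) od ->]].
  by apply: Phi2_Sset; case: d od.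
congr (_ * _); rewrite /cyclo_prod big_cat -mulrA big_map -big_split /=; congr (_ * _).
rewrite !big_seq; apply: eq_bigr => d /(allP oe) od.
by rewrite Phi1_step // mulrC.
Qed.

Lemma factored_le M N f : (M <= N)%N -> factored M f -> factored N f.
Proof.
by move=> /subnK <- h; elim: (N - M)%N => // k IH; apply: factoredS.
Qed.

Lemma unit_xn n (i j : nat) : unit_in D (x n ^+ i / x n ^+ j).
Proof.
have D_ a b : D (x n ^+ a / x n ^+ b) by apply: D_mul; [apply: D_xn | apply: D_xnV].
split=> //; exists (x n ^+ j / x n ^+ i) => //.
by rewrite mulrA mulfVK ?expf_neq0 ?x_neq0 // mulfV // expf_neq0 ?x_neq0.
Qed.

Lemma unitM u v : unit_in D u -> unit_in D v -> unit_in D (u * v).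
Proof.
move=> [Du [u' Du' e]] [Dv [v' Dv' e']]; split; first exact: D_mul.
by exists (u' * v'); [apply: D_mul | rewrite mulrACA -e -e' mulr1].
Qed.

Lemma unit_const n c : c != 0 -> unit_in D (ev n c%:P).
Proof.
move=> c0; split; first exact: D_ev.
exists (ev n (c^-1)%:P); first exact: D_ev.
by rewrite -evM -polyCM mulfV // ev1.
Qed.

Lemma poly_factor_X (p : {poly rat}) : p != 0 ->
  exists k q, p = 'X^k * q /\ q.[0] != 0.
Proof.
move=> p0; have [k [q nr ->]] := multiplicity_XsubC p 0.
exists k, q; rewrite p0 /= in nr; split; last by rewrite -rootE.
by rewrite polyC0 subr0 mulrC.
Qed.

Lemma D_factored f : D f -> f != 0 -> exists N, factored N f.
Proof.
move=> [n [p [j fE]]] f0.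
have p0 : p != 0.
  apply: contraNneq f0 => p0.
  by rewrite fE p0 (eqP (_ : ev n 0 == 0)) ?ev_eq0 ?mul0r.
have [k [q [pE q0]]] := poly_factor_X p0.
have [m [c [s [e [c0 sP oe qE]]]]] := horner0_eventually_factored q0.
exists (n + m)%N, (x n ^+ k / x n ^+ j * ev (n + m) c%:P), [seq ev (n + m) r | r <- s], e.
split=> //.
- by apply: unitM; [apply: unit_xn | apply: unit_const].
- by move=> r /mapP[r' /sP r'P ->]; apply: Sset_ev.
have ev_prod (I : Type) (t : seq I) F :
    ev (n + m) (\prod_(i <- t) F i) = \prod_(i <- t) ev (n + m) (F i).
  by elim: t => [|i t IH]; rewrite ?big_nil ?ev1 // !big_cons evM IH.
rewrite fE pE evM evXn -(ev_comp n m q) qE -mul_polyC !evM !ev_prod /cyclo_prod big_map.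
by rewrite mulrAC -!mulrA.
Qed.

Lemma unit_cancel u f : unit_in D u -> divides D (u * f) f.
Proof. by move=> [_ [v Dv e]]; exists v => //; rewrite mulrAC -e mul1r. Qed.

Lemma above_Phi2 N d d' i : odd d -> odd d' -> (N < i)%N ->
  above N d' (Phi2 d i) = (d' == d).
Proof.
move=> od od' Ni; apply/asboolP/eqP => [[j Nj]|->]; last by exists i.
by move=> /(Phi2_inj od od')[-> _].
Qed.

Lemma cyclo_val_Phi2 N s e d i : odd d -> all odd e -> (N < i)%N ->
  cyclo_val N s e (Phi2 d i) = (count_mem (Phi2 d i) s + count_mem d e)%N.
Proof.
move=> od oe Ni; congr (_ + _)%N; apply: eq_in_count => d' /(allP oe) od' /=.
by rewrite above_Phi2.
Qed.

(** At such a prime the valuation of [cyclo_prod N s e] is the multiplicity of [d] in [e], by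
    [cyclo_val_Phi2]. *)
Lemma Phi2_fresh (s : seq L) d N : odd d ->
  exists2 i, (N < i)%N & Phi2 d i \notin s.
Proof.
move=> od; apply: contrapT => h.
have all_in i : (N < i)%N -> Phi2 d i \in s.
  by move=> Ni; apply/negPn/negP => ni; apply: h; exists i.
pose t := [seq Phi2 d i | i <- seq.iota N.+1 (size s).+1].
have ut : uniq t.
  rewrite map_inj_in_uniq ?iota_uniq // => i j _ _ /(Phi2_inj od od)[_ //].
have sub : {subset t <= s}.
  by move=> p /mapP[i]; rewrite mem_iota => /andP[Ni _] ->; apply: all_in.
by have := uniq_leq_size ut sub; rewrite size_map size_iota ltnn.
Qed.

(** The valuations determine both lists of a factorization up to order, so [f] and [g] differ by a
    unit. *)
Lemma divides_of_exact_pow f g : D f -> D g -> f != 0 -> g != 0 ->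
  (forall p k, S p -> exact_pow p k f -> exact_pow p k g) -> divides D f g.
Proof.
move=> Df Dg f0 g0 h; have [M fM] := D_factored Df f0; have [M' gM] := D_factored Dg g0.
have [u [s [e [uu Ss oe fE]]]] := factored_le (leq_maxl M M') fM.
have [u' [s' [e' [uu' Ss' oe' gE]]]] := factored_le (leq_maxr M M') gM.
set N := maxn M M' in fE gE.
have cv p : S p -> cyclo_val N s e p = cyclo_val N s' e' p.
  move=> Sp; have Ef : exact_pow p (0 + cyclo_val N s e p) f.
    by rewrite fE; apply: exact_powM => //; [apply: exact_pow_unit | apply: exact_pow_cyclo_prod].
  apply: exact_pow_uniq (h _ _ Sp Ef) _; first exact: Sset_D.
  rewrite gE -[cyclo_val N s' _ _]add0n.
  by apply: exact_powM => //; [apply: exact_pow_unit | apply: exact_pow_cyclo_prod].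
(* Multiplicities in [e] and [e'] are read off at a prime [Phi2 d i] lying in neither [s] nor [s'];
   cancelling these contributions then identifies [s] and [s']. *)
have ee : perm_eq e e'.
  apply/allP => d _ /=; have [od|nod] := boolP (odd d); last first.
    by rewrite !(count_memPn _) //; apply: contra nod => /(allP _) -> //.
  have [i Ni] := Phi2_fresh (s ++ s') N od; rewrite mem_cat negb_or => /andP[is1 is2].
  have := cv (Phi2 d i) (Phi2_Sset i _); rewrite !cyclo_val_Phi2 //.
  by rewrite (count_memPn is1) (count_memPn is2) !add0n => -> //; case: d od {is1 is2}.
have ss : perm_eq s s'.
  apply/allP => p _ /=; have [Sp|nS] := pselect (S p).
    by have := cv p Sp; rewrite /cyclo_val (permP ee) => /addIn ->.
  have ns t : (forall q, q \in t -> S q) -> count_mem p t = 0%N.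
    by move=> St; apply/count_memPn/negP => pt; apply/nS/St.
  by rewrite !ns.
rewrite fE gE /cyclo_prod (perm_big _ ss) (perm_big _ ee) /= -/(cyclo_prod _ _ _).
by rewrite [u' * _]mulrC; apply: divides_mulr; [case: uu' | apply: unit_cancel].
Qed.

(** * Exponent families of products *)

Variable a : L -> nat.

Local Notation T := (Tset iota x a).

(** Conditions (1) and (2) of the theorem for given witnesses, together with the requirements on
    those witnesses. *)
Definition cofinite_shape (C : set L) (n l : nat) (d : 'I_l -> nat) : Prop :=
  [/\ C `<=` T /\ finite_set C,
      injective d /\ (forall j, odd (d j)),
      T `\` C = \bigcup_(j in [set: 'I_l]) [set Phi2 (d j) i | i in [set i | (n < i)%N]] &
      forall j, exists b : nat,
        is_min (a @` Bset iota x a n (d j)) b /\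
        finite_set [set p | Bset iota x a n (d j) p /\ a p <> b]].

Lemma exact_divs_cyclo_val f : D f -> f != 0 -> exact_divs iota x a f ->
  exists N s e, [/\ forall q, q \in s -> S q, all odd e &
    forall p, S p -> a p = cyclo_val N s e p].
Proof.
move=> Df f0 ex; have [N [u [s [e [uu Ss oe fE]]]]] := D_factored Df f0.
exists N, s, e; split=> // p Sp; apply: (exact_pow_uniq (Sset_D Sp) (ex p Sp)) => //.
rewrite fE -[cyclo_val _ _ _ _]add0n; apply: exact_powM => //.
  exact: exact_pow_unit.
exact: exact_pow_cyclo_prod.
Qed.

(** The [d j] enumerate the distinct entries of [e], and b_j is the multiplicity of [d j] in [e];
    only the finitely many primes in [s] can deviate from it. *)
Lemma cyclo_val_shape N s e : (forall q, q \in s -> S q) -> all odd e ->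
  (forall p, S p -> a p = cyclo_val N s e p) ->
  exists C n l (d : 'I_l -> nat), cofinite_shape C n d.
Proof.
move=> Ss oe aE; pose E := undup e; pose d (j : 'I_(size E)) := tnth (in_tuple E) j.
have dE j : d j \in e by rewrite -mem_undup mem_tnth.
have od j : odd (d j) by apply: (allP oe).
have d0 j : (0 < d j)%N by case: (d j) (od j).
have cnt j : (0 < count_mem (d j) e)%N by rewrite -has_count has_pred1.
have aPhi j i : (N < i)%N ->
    a (Phi2 (d j) i) = (count_mem (Phi2 (d j) i) s + count_mem (d j) e)%N.
  by move=> Ni; rewrite aE ?cyclo_val_Phi2 //; apply: Phi2_Sset.
have TPhi j i : (N < i)%N -> T (Phi2 (d j) i).
  by move=> Ni; split; [apply: Phi2_Sset | rewrite aPhi // ltn_addl].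
pose U := \bigcup_(j in [set: 'I_(size E)])
  [set Phi2 (d j) i | i in [set i | (N.+1 < i)%N]].
(* The level is [N.+1] because [Bset] admits i = n, while [aPhi] requires N < i; the primes
   [Phi2 d N.+1] therefore fall into the finite exceptional set. *)
exists (T `\` U), N.+1, (size E), d; split.
- split; first by move=> p [].
  apply: (@sub_finite_set _ _ [set` s ++ [seq Phi2 d N.+1 | d <- e]]); last first.
    exact: finite_seq.
  move=> p [[Sp ap] nU] /=; rewrite mem_cat; have [//|ps] := boolP (p \in s).
  move: ap; rewrite aE // /cyclo_val (count_memPn ps) add0n -has_count.
  move=> /hasP[d' d'e /asboolP[i]]; rewrite leq_eqVlt => /orP[/eqP<- ->|Ni pE].
    by apply/mapP; exists d'.
  case: nU; have d'E : d' \in E by rewrite mem_undup.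
  have lt : (index d' E < size E)%N by rewrite index_mem.
  exists (Ordinal lt) => //; exists i => //.
  by rewrite /d (tnth_nth 0%N) /= nth_index.
- split=> // i j; rewrite /d !(tnth_nth 0%N) /= => /eqP.
  by rewrite nth_uniq ?undup_uniq // => /eqP/val_inj.
- rewrite setDD setIidr // => p [j _ [i /= Ni <-]].
  by apply: TPhi; apply: ltnW.
move=> j; exists (count_mem (d j) e); split.
  split; last by move=> _ [p [_ [i Ni ->]] <-]; rewrite aPhi // leq_addl.
  (* The minimum is attained at a prime outside [s]. The bound N.+1 <= i required by [Bset] is N <
     i. *)
  have [i Ni si] := Phi2_fresh s N (od j).
  exists (Phi2 (d j) i); first by split; [apply: TPhi | exists i].
  by rewrite aPhi // (count_memPn si).
apply: (@sub_finite_set _ _ [set` s]); last exact: finite_seq.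
move=> p [[_ [i Ni ->]] ne] /=; apply/negPn/negP => ps; apply: ne.
by rewrite aPhi // (count_memPn ps).
Qed.

Lemma monic_nzconstM f g :
  monic_nzconst iota x f -> monic_nzconst iota x g -> monic_nzconst iota x (f * g).
Proof.
move=> [m [p [pm p0 ->]]] [n [q [qm q0 ->]]]; exists (maxn m n).
exists ((p \Po 'X^(2 ^ (maxn m n - m))) * (q \Po 'X^(2 ^ (maxn m n - n)))); split.
- by rewrite monicMl ?monic_comp_Xn // expn_gt0.
- by rewrite hornerM mulf_neq0 // horner0_comp_Xn // expn_gt0.
- by rewrite evM !ev_comp_le ?leq_maxl ?leq_maxr.
Qed.

Lemma monic_nzconst_prod (I : eqType) (s : seq I) (F : I -> L) :
  (forall i, i \in s -> monic_nzconst iota x (F i)) ->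
  monic_nzconst iota x (\prod_(i <- s) F i).
Proof.
elim: s => [|i s IH] h.
  by rewrite big_nil; exists 0%N, 1; rewrite monic1 hornerE oner_neq0 ev1.
rewrite big_cons; apply: monic_nzconstM; first by apply: h; rewrite mem_head.
by apply: IH => j js; apply: h; rewrite inE js orbT.
Qed.

Lemma monic_nzconst_cyclo_prod N s e : (forall q, q \in s -> S q) -> all odd e ->
  monic_nzconst iota x (cyclo_prod N s e).
Proof.
move=> Ss oe; apply: monic_nzconstM; apply: monic_nzconst_prod.
  by move=> q /Ss[].
move=> d /(allP oe) od; exists N, (PhiQ d); split=> //; first exact: PhiQ_monic.
by apply: PhiQ_horner0; case: d od.
Qed.

(** Condition (ii) follows from [divides_of_exact_pow]; the prime [p0] has positive valuation and so
    shows that the product is not a unit. *)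
Lemma cyclo_val_is_prod N s e p0 : (forall q, q \in s -> S q) -> all odd e ->
  (forall p, S p -> a p = cyclo_val N s e p) -> T p0 -> is_prod iota x a 1 (cyclo_prod N s e).
Proof.
move=> Ss oe aE [Sp0 ap0]; set f := cyclo_prod N s e.
have fm : monic_nzconst iota x f by apply: monic_nzconst_cyclo_prod.
have [Df f0] : D f /\ f != 0.
  case: fm => m [q [qm _ ->]]; split; first exact: D_ev.
  by rewrite ev_eq0 // monic_neq0.
have fex p : S p -> exact_pow p (a p) f.
  by move=> Sp; rewrite aE //; apply: exact_pow_cyclo_prod.
split=> //.
- split=> // uf; have := exact_pow_uniq (Sset_D Sp0) (fex _ Sp0) (exact_pow_unit Sp0 uf).
  by move=> e0; rewrite e0 in ap0.
- move=> g Dg gex.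
  (* Every power of [p0] divides 0, so 0 has no exact valuation. *)
  have g0 : g != 0.
    apply/eqP => g0; have [_ []] := gex _ Sp0; exists 0; rewrite ?g0 ?mulr0 //.
    by exists 0%N, 0, 0%N; rewrite /ev rmorph0 horner0 mul0r.
  have [h Dh gE] : divides D f g.
    apply: divides_of_exact_pow => // p k Sp fk.
    by rewrite (exact_pow_uniq (Sset_D Sp) fk (fex _ Sp)); apply: gex.
  move=> _ [y Dy <-]; exists (h * y); first exact: D_mul.
  by rewrite gE mulrA.
- split; last by exists f; rewrite ?mul1r.
  exact: unit1.
Qed.

(** The product of the [Phi1 (d j) n] to the powers b_j accounts for a part [w] of the exponents;
    the rest is supported on finitely many primes and is listed in [s]. *)
Lemma shape_cyclo_val (C : set L) n l (d : 'I_l -> nat) : cofinite_shape C n d ->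
  exists s e, [/\ forall q, q \in s -> S q, all odd e &
    forall p, S p -> a p = cyclo_val n s e p].
Proof.
move=> [[CT Cfin] [dinj od] TC /choice[b hb]].
have TPhi j i : (n < i)%N -> T (Phi2 (d j) i) /\ ~ C (Phi2 (d j) i).
  move=> ni; suff : (T `\` C) (Phi2 (d j) i) by [].
  by rewrite TC; exists j => //; exists i.
pose w p := (\sum_j b j * above n (d j) p)%N.
have w_above j p : above n (d j) p -> w p = b j.
  move=> ab; rewrite /w (bigD1 j) //= ab muln1 big1 ?addn0 // => k kj.
  case/asboolP: ab => i ni ->; rewrite above_Phi2 //.
  by rewrite (inj_eq dinj) (negPf kj) muln0.
have w0 p : (forall j, ~~ above n (d j) p) -> w p = 0%N.
  by move=> h; rewrite /w big1 // => j _; rewrite (negPf (h j)) muln0.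
have aboveB j p : above n (d j) p -> Bset iota x a n (d j) p.
  by case/asboolP => i ni ->; split; [case: (TPhi j i ni) | exists i => //; apply: ltnW].
have wa p : (w p <= a p)%N.
  have [[j ab]|nex] := pselect (exists j, above n (d j) p).
    rewrite (w_above j) //; have [[_ le] _] := hb j; apply: le.
    by exists p => //; apply: aboveB.
  by rewrite w0 // => j; apply/negP => ab; apply: nex; exists j.
pose c p := (a p - w p)%N.
(* A remainder is left only at primes in [C] and at the finitely many exceptions allowed by
   condition (2). *)
have cfin : finite_set [set p | S p /\ c p != 0%N].
  apply: (@sub_finite_set _ _ (C `|` \bigcup_(j in [set: 'I_l])
      [set p | Bset iota x a n (d j) p /\ a p <> b j])); last first.
    rewrite finite_setU; split=> //; apply: bigcup_finite => // j _.
    by have [] := hb j.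
  move=> p [Sp cp]; have Tp : T p by split=> //; move: cp; rewrite /c; lia.
  have [Cp|nC] := pselect (C p); [by left|right].
  have : (T `\` C) p by [].
  rewrite TC => -[j _ [i /= ni pE]]; exists j => //.
  have ab : above n (d j) p by apply/asboolP; exists i.
  split; first exact: aboveB.
  by move: cp; rewrite /c (w_above _ _ ab) => cp e; rewrite e subnn in cp.
have [s0 s0E] := (finite_seqP _).1 cfin.
have s0P p : p \in undup s0 <-> S p /\ c p != 0%N.
  by rewrite mem_undup; have -> : (p \in s0) = [set` s0] p :> Prop by []; rewrite -s0E.
exists (flatten [seq nseq (c p) p | p <- undup s0]).
exists (flatten [seq nseq (b j) (d j) | j <- index_enum 'I_l]); split.
- by move=> q /flatten_mapP[p /s0P[Sp _]]; rewrite mem_nseq => /andP[_ /eqP->].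
- by apply/allP => k /flatten_mapP[j _]; rewrite mem_nseq => /andP[_ /eqP->].
move=> p Sp; rewrite /cyclo_val !count_flatten_nseq -/(w p).
suff -> : (\sum_(q <- undup s0) c q * (q == p) = c p)%N by rewrite subnK.
have [ps|ps] := boolP (p \in undup s0).
  rewrite (bigD1_seq p) ?undup_uniq //= eqxx muln1 big1 ?addn0 // => q /negPf->.
  by rewrite muln0.
rewrite big1_seq; last first.
  by move=> q /= qs; case: eqP => [e|]; rewrite ?muln0 //; rewrite e (negPf ps) in qs.
by apply/esym/eqP/negPn/negP => cp; case/negP: ps; apply/s0P.
Qed.

End DyadicRing.

Theorem proposition5p8 (L : fieldType) (iota : {rmorphism rat -> L})
    (x : nat -> L) (hx : dyadic_roots iota x)
    (a : L -> nat) (hT : infinite_set (Tset iota x a)) :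
  (prod_in_D iota x a <->
   exists (C : set L) (n l : nat) (d : 'I_l -> nat),
     [/\ C `<=` Tset iota x a /\ finite_set C,
         injective d /\ (forall j, odd (d j)),
         Tset iota x a `\` C =
           \bigcup_(j in [set: 'I_l])
             [set Phi2 iota x (d j) i | i in [set i | (n < i)%N]] &
         forall j, exists b : nat,
           is_min (a @` Bset iota x a n (d j)) b /\
           finite_set [set p | Bset iota x a n (d j) p /\ a p <> b]]) /\
  (prod_in_D iota x a -> finite_set (a @` Sset iota x)).
Proof.
split; [split|].
- move=> [f [[Df f0 _] fex _ _]].
  have [N [s [e [Ss oe aE]]]] := exact_divs_cyclo_val hx Df f0 fex.
  have [C [n [l [d dC]]]] := cyclo_val_shape hx Ss oe aE.
  by exists C, n, l, d.
- move=> [C [n [l [d /(shape_cyclo_val hx)[s [e [Ss oe aE]]]]]]].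
  have [T0|/set0P[p Tp]] := eqVneq (Tset iota x a) set0.
    by case: hT; rewrite T0; apply: finite_set0.
  by exists (cyclo_prod iota x n s e); apply: cyclo_val_is_prod Tp.
- move=> [f [[Df f0 _] fex _ _]].
  have [N [s [e [Ss oe aE]]]] := exact_divs_cyclo_val hx Df f0 fex.
  (* Each valuation is a sum of a count in [s] and a count in [e], hence bounded by the two
     lengths. *)
  apply: (@sub_finite_set _ _ `I_(size s + size e).+1); last exact: finite_II.
  move=> _ [p Sp <-] /=; rewrite aE // ltnS leq_add ?count_size //.
Qed.
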